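(* Let $r\ge 1$ and $p\ge 1$ be integers and let $f\in D^{r,1}([0,1])$. For $n\ge r+p-1$ let $F_{n,p}$ be the boundary data matrix obtained from the samples $f(j/n)$, $0\le j\le n$, using one-sided finite difference formulas of order of accuracy $p$ for the derivatives $f^{(m)}$, $1\le m\le r$, at $0$ and $1$, and let $\mathcal{T}^d_{n,2}(\hat f^d_c)$ be the corresponding interpolating discrete Fourier continuation approximation, all as defined in the context. Then, as $n\to\infty$, $$\Vert \mathcal{T}^d_{n,2}(\hat f^d_c)-f\Vert_{\infty,[0,1]}=\mathcal{O}\left(\frac{1}{n^{\min\{p,r\}+1}}\right).$$
   Context: Function spaces. A function $g$ is in $C_{pw}([\alpha,\beta])$ if there are finitely many points $\alpha=a_0<\dots<a_{n_d}=\beta$ such that each restriction $g|_{(a_j,a_{j+1})}$ extends to a continuous function on $[a_j,a_{j+1}]$; $g\in C^{\ell}_{pw}([\alpha,\beta])$ iff $g^{(\ell)}\in C_{pw}([\alpha,\beta])$ (the derivative may fail to exist at finitely many points). $D^{r,1}([\alpha,\beta])=C^r([\alpha,\beta])\cap C^{r+2}_{pw}([\alpha,\beta])$, for real-valued functions. Grid data. $x_j=j/n$ and $f_j=f(x_j)$ for $j=0,\dots,n$. Boundary data. $F_{n,p}=(f_{j,m})_{0\le j\le1,\,0\le m\le r}$ is the real $2\times(r+1)$ matrix with $f_{0,0}=f(0)$, $f_{1,0}=f(1)$ and, for $1\le m\le r$, $f_{0,m}=\mathcal{D}^{m,+}_{n,p}(f)(x_0)$, $f_{1,m}=\mathcal{D}^{m,-}_{n,p}(f)(x_n)$,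 where $$\mathcal{D}^{m,\pm}_{n,p}(f)(x_\ell)=(\pm n)^m\sum_{k=0}^{m+p-1}(a^m_p)_k\,f_{\ell\pm k}$$ with constants $(a^m_p)_k$ independent of $n$. These are forward/backward finite difference formulas of order of accuracy $p$ for $f^{(m)}$, meaning that $|f_{0,m}-f^{(m)}(0)|=\mathcal{O}(n^{-p})$ and $|f_{1,m}-f^{(m)}(1)|=\mathcal{O}(n^{-p})$ as $n\to\infty$ for $1\le m\le r$. Hermite continuation. For a real $2\times(r+1)$ matrix $A=(a_{jm})_{0\le j\le 1,0\le m\le r}$, $$\mathcal{P}_r(A)(x)=(1+x)^{r+1}\sum_{m=0}^r\frac{a_{0m}}{m!}\sum_{q=0}^{r-m}(-1)^q\binom{r+q}{q}x^{m+q}+(-x)^{r+1}\sum_{m=0}^r\frac{a_{1m}}{m!}\sum_{q=0}^{r-m}\binom{r+q}{q}(1+x)^{m+q}.$$ Discrete continuation. $(\hat f^d_c)_j=f_j$ for $j=0,\dots,n$ and $(\hat f^d_c)_j=\mathcal{P}_r(F_{n,p})(j/n)$ for $j=-n,\dots,-1$. Discrete approximation. $c^d_k(\hat f^d_c)=\frac{1}{2n}\sum_{j=-n}^{n-1}(\hat f^d_c)_j e^{-\pi i jk/n}$ for $k=-n,\dots,n-1$, and $\mathcal{T}^d_{n,2}(\hat f^d_c)(x)=\sum_{k=-n}^{n-1}c^d_k(\hat f^d_c)e^{\pi i kx}$. $\Vert h\Vert_{\infty,[0,1]}=\max_{x\in[0,1]}|h(x)|$. *)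

(* Defs.v *)
From Stdlib Require Import Reals ZArith List.
From Coquelicot Require Import Coquelicot.

Set Implicit Arguments.
Unset Strict Implicit.

Open Scope R_scope.

(** * Functions on a compact interval

    A function on [[a, b]] is represented by a total [f : R -> R] of which only
    the values on [[a, b]] matter: all limits below are taken within [[a, b]]. *)

Definition Icc (a b : R) : R -> Prop := fun x => a <= x <= b.

(** Coquelicot's [is_derive], with the neighbourhoods of [x] restricted to [I];
    at an endpoint of [I = Icc a b] it is the one-sided derivative. *)
Definition is_derive_on (I : R -> Prop) (f : R -> R) (x l : R) : Prop :=
  filterdiff f (within I (locally x)) (fun y : R => scal y l).

Definition ex_derive_on (I : R -> Prop) (f : R -> R) (x : R) : Prop :=
  exists l : R, is_derive_on I f x l.

(** As with [Derive], the value is meaningful only under [ex_derive_on]. *)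
Definition Derive_on (I : R -> Prop) (f : R -> R) (x : R) : R :=
  iota (fun l : R => is_derive_on I f x l).

Fixpoint Derive_n_on (I : R -> Prop) (f : R -> R) (m : nat) : R -> R :=
  match m with
  | O => f
  | S m' => Derive_on I (Derive_n_on I f m')
  end.

Definition C_r (r : nat) (a b : R) (g : R -> R) : Prop :=
  (forall k : nat, (k < r)%nat -> forall x : R, Icc a b x ->
     ex_derive_on (Icc a b) (Derive_n_on (Icc a b) g k) x)
  /\ continuous_on (Icc a b) (Derive_n_on (Icc a b) g r).

Definition C_pw (a b : R) (g : R -> R) : Prop :=
  exists (N : nat) (s : nat -> R),
    s 0%nat = a /\ s N = b /\
    (forall j : nat, (j < N)%nat -> s j < s (S j)) /\
    forall j : nat, (j < N)%nat ->
      exists h : R -> R,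
        continuous_on (Icc (s j) (s (S j))) h /\
        forall x : R, s j < x < s (S j) -> h x = g x.

(** The derivatives of all orders [<= l] are required off the finite set [e]:
    since [Derive_n_on] is total, the existence of the derivative of order [l]
    alone would say nothing about the lower ones.  The values of
    [Derive_n_on] at the points of [e] are irrelevant to [C_pw]. *)
Definition C_pw_r (l : nat) (a b : R) (g : R -> R) : Prop :=
  (exists e : list R, forall x : R, Icc a b x -> ~ In x e ->
     forall k : nat, (k < l)%nat ->
       ex_derive_on (Icc a b) (Derive_n_on (Icc a b) g k) x)
  /\ C_pw a b (Derive_n_on (Icc a b) g l).

Definition D_r1 (r : nat) (a b : R) (g : R -> R) : Prop :=
  C_r r a b g /\ C_pw_r (r + 2) a b g.

(** * Asymptotics and the uniform norm *)

Definition big_O (u : nat -> Rbar) (v : nat -> R) : Prop :=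
  exists K : R,
    eventually (fun n : nat => Rbar_le (Rbar_abs (u n)) (Finite (K * Rabs (v n)))).

(** Extended-real valued, so that an unbounded function has norm [p_infty];
    for a function continuous on [[a, b]] it is the maximum of its modulus. *)
Definition norm_infty (a b : R) (h : R -> C) : Rbar :=
  Lub_Rbar (fun y : R => exists x : R, Icc a b x /\ y = Cmod (h x)).

(** * Finite differences and boundary data *)

(** [fx f n j] is [f_j = f (j / n)]. *)
Definition fx (f : R -> R) (n : nat) (j : Z) : R := f (IZR j / INR n).

(** The formula at [x_l] with coefficients [c k = (a^m_p)_k]:
    forward for [s = 1], backward for [s = -1]. *)
Definition fin_diff (s : Z) (c : nat -> R) (p n m : nat) (f : R -> R) (l : Z) : R :=
  (IZR s * INR n) ^ m *
  sum_n (fun k : nat => c k * fx f n (l + s * Z.of_nat k)) (m + p - 1).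

(** [a m k] is [(a^m_p)_k]; the row [a 0] is not used. *)
Definition bdry_data (r p n : nat) (a : nat -> nat -> R) (f : R -> R) :
    @matrix R 2 (S r) :=
  mk_matrix 2 (S r) (fun j m : nat =>
    match j, m with
    | O, O => f 0
    | S _, O => f 1
    | O, S _ => fin_diff 1 (a m) p n m f 0
    | S _, S _ => fin_diff (-1) (a m) p n m f (Z.of_nat n)
    end).

(** * The continuation and its trigonometric interpolant *)

Definition Hermite_P (r : nat) (A : @matrix R 2 (S r)) (x : R) : R :=
  (1 + x) ^ (r + 1) *
    sum_n (fun m : nat => coeff_mat 0 A 0 m / INR (fact m) *
      sum_n (fun q : nat => (-1) ^ q * Binomial.C (r + q) q * x ^ (m + q)) (r - m)) r
  + (- x) ^ (r + 1) *
    sum_n (fun m : nat => coeff_mat 0 A 1 m / INR (fact m) *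
      sum_n (fun q : nat => Binomial.C (r + q) q * (1 + x) ^ (m + q)) (r - m)) r.

Definition disc_cont (r p n : nat) (a : nat -> nat -> R) (f : R -> R) (j : Z) : R :=
  if (0 <=? j)%Z then fx f n j
  else Hermite_P (bdry_data r p n a f) (IZR j / INR n).

Definition expi (t : R) : C := (cos t, sin t).

(** The sum of [u k] over the integers [-n <= k <= n - 1], for [1 <= n]. *)
Definition sum_sym (n : nat) (u : Z -> C) : C :=
  sum_n (fun i : nat => u (Z.of_nat i - Z.of_nat n)%Z) (2 * n - 1).

Definition disc_coef (n : nat) (u : Z -> R) (k : Z) : C :=
  (RtoC (/ (2 * INR n)) *
   sum_sym n (fun j : Z => RtoC (u j) * expi (- PI * IZR j * IZR k / INR n)))%C.

Definition disc_fourier (n : nat) (u : Z -> R) (x : R) : C :=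
  sum_sym n (fun k : Z => (disc_coef n u k * expi (PI * IZR k * x))%C).

(* Main.v *)
Require Import Defs.
From Stdlib Require Import Reals ZArith List Lra Lia.
From Coquelicot Require Import Coquelicot.

(** The argument is discrete throughout: no integral and no Fourier series
    occurs.  Let [I_n] be trigonometric interpolation on the [2 n] points of
    step [1 / n], let [G] be the continuation made [2]-periodic, and refine the
    grid to step [1 / N] with [N = n M].  On the fine grid [G] equals the sum of
    its [2 N] discrete exponentials, and [I_n G] depends only on fine grid
    values; since [I_n] reproduces the exponentials of frequency
    [- n <= k < n] and maps the other ones, by aliasing, to functions of
    modulus [1], on the fine grid the error is at most
    [2 * sum_(n <= |k| <= N) |c_k|] ([trig_error_fine_grid]).  This bound will
    be uniform in [M], so continuity and [M -> oo] give it on all of [[0, 1]].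

    The coefficients decay by summation by parts: [s + 2] of them turn
    [sum_j |D^(s+2) G_j| = O(N^-(s+1))] into [|c_k| = O(|k|^-(s+2))]
    ([dft_decay]), whence an error [O(n^-(s+1))].  The hypothesis on the
    differences holds when [G] is [C^s] and piecewise [C^(s+2)]: they are
    [O(N^-(s+2))] except on boundedly many stencils, where they are
    [O(N^-(s+1))] ([periodized_variation]).  Inside [[0, 1]] this comes from the
    mean value theorem ([D_r1_diff_piecewise]).  Across the junctions [0] and
    [1] no derivative of the glued function is needed: the Taylor polynomials
    of the two pieces agree there ([hermite_contact]), so that on these
    stencils [G] differs from a polynomial by [O(N^-(s+1))].  The outcome is [continuation_error].

    It is applied twice.  With [s = r], to the Hermite continuation of the exact
    derivatives, it gives [O(n^-(r+1))].  The finite differences perturb these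
    derivatives, but not the values of [f], by [O(n^-p)]; the corresponding
    Hermite basis functions vanish at both junctions, so their continuations by
    [0] to [[0, 1]] are continuous, and [s = 0] gives an error
    [O(n^-p) * O(n^-1)] ([perturbation_error]). *)

(** * Finite sums *)

Fixpoint csum (u : nat -> C) (n : nat) : C :=
  match n with
  | O => RtoC 0
  | S n' => (csum u n' + u n')%C
  end.

Fixpoint rsum (u : nat -> R) (n : nat) : R :=
  match n with
  | O => 0
  | S n' => rsum u n' + u n'
  end.

Lemma csum_ext (u v : nat -> C) (n : nat) :
  (forall i, (i < n)%nat -> u i = v i) -> csum u n = csum v n.
Proof.
  induction n as [|n IH]; intros H; simpl; auto.
  rewrite IH, (H n) by auto. reflexivity.
Qed.

Lemma csum_plus (u v : nat -> C) (n : nat) :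
  csum (fun i => u i + v i)%C n = (csum u n + csum v n)%C.
Proof. induction n as [|n IH]; simpl; [|rewrite IH]; ring. Qed.

Lemma csum_scal_l (c : C) (u : nat -> C) (n : nat) :
  csum (fun i => c * u i)%C n = (c * csum u n)%C.
Proof. induction n as [|n IH]; simpl; [|rewrite IH]; ring. Qed.

Lemma csum_scal_r (c : C) (u : nat -> C) (n : nat) :
  csum (fun i => u i * c)%C n = (csum u n * c)%C.
Proof. induction n as [|n IH]; simpl; [|rewrite IH]; ring. Qed.

Lemma csum_zero (u : nat -> C) (n : nat) :
  (forall i, (i < n)%nat -> u i = RtoC 0) -> csum u n = RtoC 0.
Proof.
  induction n as [|n IH]; intros H; simpl; auto.
  rewrite IH, (H n) by auto. ring.
Qed.

Lemma csum_single (u : nat -> C) (n i0 : nat) :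
  (i0 < n)%nat -> (forall i, (i < n)%nat -> i <> i0 -> u i = RtoC 0) ->
  csum u n = u i0.
Proof.
  induction n as [|n IH]; intros Hi H; [lia|]. simpl.
  destruct (Nat.eq_dec i0 n) as [->|Hn].
  - rewrite csum_zero; [ring|]. intros i Hi'. apply H; lia.
  - rewrite IH, (H n) by (auto with arith || lia). ring.
Qed.

Lemma csum_swap (u : nat -> nat -> C) (n m : nat) :
  csum (fun i => csum (u i) m) n = csum (fun j => csum (fun i => u i j) n) m.
Proof.
  induction n as [|n IH]; simpl.
  - symmetry. apply csum_zero. reflexivity.
  - rewrite IH, <- csum_plus. reflexivity.
Qed.

Lemma csum_shift (u : nat -> C) (n : nat) :
  csum (fun i => u (S i)) n = (csum u n + u n - u 0%nat)%C.
Proof. induction n as [|n IH]; simpl; [|rewrite IH]; ring. Qed.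

Lemma csum_mod (u : nat -> C) (n : nat) :
  Cmod (csum u n) <= rsum (fun i => Cmod (u i)) n.
Proof.
  induction n as [|n IH]; simpl.
  - rewrite Cmod_0. lra.
  - eapply Rle_trans; [apply Cmod_triangle|]. lra.
Qed.

Lemma rsum_le (u v : nat -> R) (n : nat) :
  (forall i, (i < n)%nat -> u i <= v i) -> rsum u n <= rsum v n.
Proof.
  induction n as [|n IH]; intros H; simpl; [lra|].
  assert (rsum u n <= rsum v n) by auto. specialize (H n ltac:(lia)). lra.
Qed.

Lemma rsum_plus (u v : nat -> R) (n : nat) :
  rsum (fun i => u i + v i) n = rsum u n + rsum v n.
Proof. induction n as [|n IH]; simpl; [|rewrite IH]; ring. Qed.

Lemma rsum_scal_l (c : R) (u : nat -> R) (n : nat) :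
  rsum (fun i => c * u i) n = c * rsum u n.
Proof. induction n as [|n IH]; simpl; [|rewrite IH]; ring. Qed.

Lemma rsum_const (c : R) (n : nat) : rsum (fun _ => c) n = INR n * c.
Proof. induction n as [|n IH]; [simpl; ring|]. rewrite S_INR. simpl. rewrite IH. ring. Qed.

Lemma rsum_cat (u : nat -> R) (n m : nat) :
  rsum u (n + m) = rsum u n + rsum (fun i => u (n + i)%nat) m.
Proof.
  induction m as [|m IH]; [rewrite Nat.add_0_r; simpl; ring|].
  rewrite Nat.add_succ_r. simpl. rewrite IH. ring.
Qed.

(** * The exponentials on a uniform grid *)

Lemma expi_plus (s t : R) : expi (s + t) = (expi s * expi t)%C.
Proof.
  unfold expi, Cmult. simpl. rewrite cos_plus, sin_plus.
  f_equal; ring.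
Qed.

Lemma expi_0 : expi 0 = RtoC 1.
Proof. unfold expi. rewrite cos_0, sin_0. reflexivity. Qed.

Lemma Cmod_expi (t : R) : Cmod (expi t) = 1.
Proof.
  unfold Cmod, expi. simpl. transitivity (sqrt 1); [f_equal|apply sqrt_1].
  transitivity (Rsqr (sin t) + Rsqr (cos t)); [unfold Rsqr; ring | apply sin2_cos2].
Qed.

Lemma expi_period (t : R) (k : Z) : expi (t + 2 * PI * IZR k) = expi t.
Proof.
  assert (H : forall m t, expi (t + 2 * PI * INR m) = expi t).
  { intros m s. unfold expi.
    replace (2 * PI * INR m) with (2 * INR m * PI) by ring.
    rewrite cos_period, sin_period. reflexivity. }
  destruct (Z_le_gt_dec 0 k) as [Hk|Hk].
  - rewrite <- (Z2Nat.id k Hk), <- INR_IZR_INZ. apply H.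
  - rewrite <- (H (Z.to_nat (- k)) (t + 2 * PI * IZR k)).
    rewrite INR_IZR_INZ, Z2Nat.id, opp_IZR by lia. f_equal. ring.
Qed.

Lemma Cmod_expi_sub_1 (t : R) : Cmod (expi t - RtoC 1) = 2 * Rabs (sin (t / 2)).
Proof.
  replace (2 * Rabs (sin (t / 2))) with (Rabs (2 * sin (t / 2)))
    by (rewrite Rabs_mult, (Rabs_pos_eq 2); lra).
  rewrite <- sqrt_Rsqr_abs. unfold Cmod. f_equal.
  unfold expi, Rsqr. simpl.
  replace (cos t) with (1 - 2 * sin (t / 2) * sin (t / 2))
    by (rewrite <- cos_2a_sin; f_equal; field).
  replace (sin t) with (2 * sin (t / 2) * cos (t / 2))
    by (rewrite <- sin_2a; f_equal; field).
  generalize (sin2_cos2 (t / 2)). unfold Rsqr. intros H.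
  set (s := sin (t / 2)) in *. set (c := cos (t / 2)) in *.
  transitivity (4 * (s * s) * (s * s + c * c)); [ring|].
  rewrite H. ring.
Qed.

(** From [sin y >= y - y^3 / 6] and [y^2 <= 4]. *)
Lemma sin_ge_third (y : R) : 0 <= y <= PI / 2 -> y / 3 <= sin y.
Proof.
  intros [Hy1 Hy2]. pose proof PI_4.
  destruct (pre_sin_bound y 0 Hy1 ltac:(lra)) as [Hs _].
  unfold sin_approx, sin_term in Hs. simpl in Hs.
  eapply Rle_trans; [|exact Hs].
  assert (0 <= y * (4 - y * y)); [|nra].
  apply Rmult_le_pos; nra.
Qed.

(** [Cmod (expi t - 1)] is the chord of the arc [t], comparable with [|t|] up
    to the half-turn; this is what makes summation by parts gain powers of the
    frequency. *)
Lemma Cmod_expi_sub_1_ge (t : R) : Rabs t <= PI -> Rabs t / 3 <= Cmod (expi t - RtoC 1).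
Proof.
  intros Ht. rewrite Cmod_expi_sub_1.
  assert (Hw : forall s, 0 <= s <= PI -> s / 3 <= 2 * Rabs (sin (s / 2))).
  { intros s Hs. pose proof (sin_ge_third (s / 2) ltac:(lra)).
    pose proof (Rle_abs (sin (s / 2))). lra. }
  unfold Rabs in Ht |- * at 1. unfold Rabs at 1.
  destruct (Rcase_abs t) as [Hn|Hn].
  - specialize (Hw (- t) ltac:(lra)).
    replace (- t / 2) with (- (t / 2)) in Hw by field.
    rewrite sin_neg, Rabs_Ropp in Hw. exact Hw.
  - apply Hw. lra.
Qed.

Lemma Cmod_expi_sub_le (s t : R) : Cmod (expi s - expi t) <= Rabs (s - t).
Proof.
  replace (expi s) with (expi t * expi (s - t))%C
    by (rewrite <- expi_plus; f_equal; ring).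
  replace (expi t * expi (s - t) - expi t)%C
    with (expi t * (expi (s - t) - RtoC 1))%C by ring.
  rewrite Cmod_mult, Cmod_expi, Cmod_expi_sub_1, Rmult_1_l.
  assert (H : forall y, 0 <= y -> Rabs (sin y) <= y).
  { intros y Hy. destruct (Req_dec y 0) as [->|Hy0].
    - rewrite sin_0, Rabs_R0. lra.
    - assert (sin y < y) by (apply sin_lt_x; lra).
      destruct (Rle_lt_dec 1 y) as [H1|H1].
      + apply Rle_trans with 1; auto. apply Rabs_le. apply SIN_bound.
      + rewrite Rabs_pos_eq; [lra|]. apply sin_ge_0; [lra|].
        pose proof PI2_1. lra. }
  generalize (s - t). intros z. unfold Rabs at 2.
  destruct (Rcase_abs z).
  - specialize (H (- z / 2) ltac:(lra)).
    replace (- z / 2) with (- (z / 2)) in H by field.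
    rewrite sin_neg, Rabs_Ropp in H. lra.
  - specialize (H (z / 2) ltac:(lra)). lra.
Qed.

Lemma csum_geometric (t : R) (n : nat) :
  ((expi t - RtoC 1) * csum (fun i => expi (t * INR i)) n
   = expi (t * INR n) - RtoC 1)%C.
Proof.
  induction n as [|n IH]; simpl csum.
  - simpl INR. rewrite Rmult_0_r, expi_0. ring.
  - rewrite Cmult_plus_distr_l, IH, S_INR, Rmult_plus_distr_l, Rmult_1_r, expi_plus. ring.
Qed.

(** Sums over [- n <= k < n]; unlike [sum_sym] they are empty for [n = 0]. *)
Definition ssum (n : nat) (u : Z -> C) : C :=
  csum (fun i => u (Z.of_nat i - Z.of_nat n)%Z) (2 * n).

Lemma sum_n_csum (u : nat -> C) (n : nat) : sum_n u n = csum u (S n).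
Proof.
  induction n as [|n IH].
  - rewrite sum_O. simpl. ring.
  - rewrite sum_Sn, IH. reflexivity.
Qed.

Lemma sum_sym_ssum (n : nat) (u : Z -> C) : (1 <= n)%nat -> sum_sym n u = ssum n u.
Proof.
  intros Hn. unfold sum_sym, ssum. rewrite sum_n_csum. f_equal. lia.
Qed.

Lemma ssum_ext (n : nat) (u v : Z -> C) :
  (forall k, (- Z.of_nat n <= k < Z.of_nat n)%Z -> u k = v k) -> ssum n u = ssum n v.
Proof. intros H. apply csum_ext. intros i Hi. apply H. lia. Qed.

Lemma ssum_single (n : nat) (u : Z -> C) (k0 : Z) :
  (- Z.of_nat n <= k0 < Z.of_nat n)%Z ->
  (forall k, (- Z.of_nat n <= k < Z.of_nat n)%Z -> k <> k0 -> u k = RtoC 0) ->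
  ssum n u = u k0.
Proof.
  intros Hk H. unfold ssum.
  rewrite (csum_single _ _ (Z.to_nat (k0 + Z.of_nat n))); [|lia|].
  - f_equal. lia.
  - intros i Hi Hne. apply H; lia.
Qed.

Lemma ssum_swap (n m : nat) (u : Z -> Z -> C) :
  ssum n (fun j => ssum m (u j)) = ssum m (fun k => ssum n (fun j => u j k)).
Proof. unfold ssum. apply csum_swap. Qed.

Lemma ssum_plus (n : nat) (u v : Z -> C) :
  ssum n (fun k => u k + v k)%C = (ssum n u + ssum n v)%C.
Proof. apply csum_plus. Qed.

Lemma ssum_scal_l (c : C) (n : nat) (u : Z -> C) :
  ssum n (fun k => c * u k)%C = (c * ssum n u)%C.
Proof. apply csum_scal_l. Qed.

Lemma ssum_scal_r (c : C) (n : nat) (u : Z -> C) :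
  ssum n (fun k => u k * c)%C = (ssum n u * c)%C.
Proof. apply csum_scal_r. Qed.

Lemma ssum_shift (n : nat) (u : Z -> C) :
  u (Z.of_nat n) = u (- Z.of_nat n)%Z -> ssum n (fun k => u (k + 1)%Z) = ssum n u.
Proof.
  intros H. unfold ssum.
  rewrite (csum_ext _ (fun i => u (Z.of_nat (S i) - Z.of_nat n)%Z)).
  - rewrite (csum_shift (fun i => u (Z.of_nat i - Z.of_nat n)%Z)).
    replace (Z.of_nat (2 * n) - Z.of_nat n)%Z with (Z.of_nat n) by lia.
    replace (Z.of_nat 0 - Z.of_nat n)%Z with (- Z.of_nat n)%Z by lia.
    rewrite H. ring.
  - intros i Hi. f_equal. lia.
Qed.

(** Orthogonality of the discrete exponentials: the sum is geometric, with a
    ratio different from [1] whose power [2 n] is [1]. *)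
Lemma ssum_expi (n : nat) (l : Z) :
  (1 <= n)%nat -> l <> 0%Z -> (Z.abs l < 2 * Z.of_nat n)%Z ->
  ssum n (fun k => expi (PI * IZR k * IZR l / INR n)) = RtoC 0.
Proof.
  intros Hn Hl0 Hl. pose proof (lt_0_INR n ltac:(lia)) as HN.
  unfold ssum. set (t := PI * IZR l / INR n).
  rewrite (csum_ext _ (fun i => expi (- PI * IZR l) * expi (t * INR i))%C).
  2:{ intros i Hi. rewrite <- expi_plus. f_equal.
      rewrite minus_IZR, <- !INR_IZR_INZ. unfold t. field. lra. }
  rewrite csum_scal_l.
  assert (Hw : (expi t - RtoC 1)%C <> RtoC 0).
  { intros E. apply (f_equal Cmod) in E. rewrite Cmod_expi_sub_1, Cmod_0 in E.
    assert (Hs : sin (t / 2) = 0).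
    { destruct (Req_dec (sin (t / 2)) 0) as [|Hne]; auto.
      apply Rabs_no_R0 in Hne. lra. }
    assert (Hb : forall k, (0 < k < 2 * Z.of_nat n)%Z -> 0 < sin (PI * IZR k / INR n / 2)).
    { intros k [Hk1 Hk2]. apply IZR_lt in Hk1. apply IZR_lt in Hk2.
      rewrite mult_IZR, <- INR_IZR_INZ in Hk2. pose proof PI_RGT_0.
      assert (E' : PI * IZR k / INR n / 2 = PI * (IZR k / (2 * INR n))) by (field; lra).
      rewrite E'. assert (0 < IZR k / (2 * INR n)) by (apply Rdiv_lt_0_compat; lra).
      assert (IZR k / (2 * INR n) < 1) by (apply Rlt_div_l; lra).
      apply sin_gt_0; nra. }
    unfold t in Hs. destruct (Z_lt_ge_dec 0 l).
    - specialize (Hb l ltac:(lia)). lra.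
    - specialize (Hb (- l)%Z ltac:(lia)). rewrite opp_IZR in Hb.
      replace (PI * - IZR l / INR n / 2) with (- (PI * IZR l / INR n / 2)) in Hb
        by (field; lra).
      rewrite sin_neg in Hb. lra. }
  assert (Hg : csum (fun i => expi (t * INR i)) (2 * n) = RtoC 0).
  { pose proof (csum_geometric t (2 * n)) as G.
    replace (t * INR (2 * n)) with (0 + 2 * PI * IZR l) in G
      by (rewrite mult_INR; unfold t; simpl (INR 2); field; lra).
    rewrite expi_period, expi_0 in G.
    replace (RtoC 1 - RtoC 1)%C with (RtoC 0) in G by ring.
    destruct (Ceq_dec (csum (fun i => expi (t * INR i)) (2 * n)) (RtoC 0)) as [|Hne]; auto.
    exfalso. exact (Cmult_neq_0 _ _ Hw Hne G). }
  rewrite Hg. ring.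
Qed.

(** * Discrete Fourier coefficients and trigonometric interpolation *)

Definition dft (n : nat) (v : Z -> C) (k : Z) : C :=
  (RtoC (/ (2 * INR n)) *
   ssum n (fun j => v j * expi (- PI * IZR j * IZR k / INR n)))%C.

Definition trig (n : nat) (v : Z -> C) (x : R) : C :=
  ssum n (fun k => dft n v k * expi (PI * IZR k * x))%C.

Lemma disc_fourier_trig (n : nat) (u : Z -> R) (x : R) : (1 <= n)%nat ->
  disc_fourier n u x = trig n (fun j => RtoC (u j)) x.
Proof.
  intros Hn. unfold disc_fourier, trig. rewrite sum_sym_ssum by auto.
  apply ssum_ext. intros k _. unfold disc_coef, dft. rewrite sum_sym_ssum by auto.
  reflexivity.
Qed.

Lemma trig_ext (n : nat) (v w : Z -> C) (x : R) :
  (forall k, (- Z.of_nat n <= k < Z.of_nat n)%Z -> v k = w k) -> trig n v x = trig n w x.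
Proof.
  intros H. unfold trig, dft. apply ssum_ext. intros k _. do 2 f_equal.
  apply ssum_ext. intros j Hj. rewrite H by auto. reflexivity.
Qed.

Lemma trig_plus (n : nat) (v w : Z -> C) (x : R) :
  trig n (fun j => v j + w j)%C x = (trig n v x + trig n w x)%C.
Proof.
  unfold trig. rewrite <- ssum_plus. apply ssum_ext. intros k _. unfold dft.
  rewrite <- Cmult_plus_distr_r, <- Cmult_plus_distr_l, <- ssum_plus.
  do 2 f_equal. apply ssum_ext. intros j _. ring.
Qed.

Lemma trig_scal (n : nat) (c : C) (v : Z -> C) (x : R) :
  trig n (fun j => c * v j)%C x = (c * trig n v x)%C.
Proof.
  unfold trig. rewrite <- ssum_scal_l. apply ssum_ext. intros k _. unfold dft.
  rewrite (ssum_ext n _ (fun j => c * (v j * expi (- PI * IZR j * IZR k / INR n)))%C)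
    by (intros; ring).
  rewrite ssum_scal_l. ring.
Qed.

Lemma trig_csum (n : nat) (w : nat -> Z -> C) (x : R) (L : nat) :
  trig n (fun j => csum (fun i => w i j) L) x = csum (fun i => trig n (w i) x) L.
Proof.
  induction L as [|L IH]; simpl.
  - rewrite (trig_ext n _ (fun j => RtoC 0 * RtoC 0)%C) by (intros; ring).
    rewrite trig_scal. ring.
  - rewrite trig_plus, IH. reflexivity.
Qed.

(** Both the inversion formula and the exactness of interpolation on the
    exponentials [- n <= k < n] are this evaluation of a character sum. *)
Lemma mean_character (n : nat) (a b : Z) : (1 <= n)%nat ->
  (- Z.of_nat n <= a < Z.of_nat n)%Z -> (- Z.of_nat n <= b < Z.of_nat n)%Z ->
  (RtoC (/ (2 * INR n)) *
   ssum n (fun j => expi (PI * IZR j * IZR (a - b) / INR n)))%C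
  = if Z.eq_dec b a then RtoC 1 else RtoC 0.
Proof.
  intros Hn Ha Hb. pose proof (lt_0_INR n ltac:(lia)) as HN.
  destruct (Z.eq_dec b a) as [->|Hne].
  - rewrite Z.sub_diag. unfold ssum.
    rewrite (csum_ext _ (fun _ => RtoC 1)).
    2:{ intros i _. rewrite <- expi_0. f_equal. field. lra. }
    assert (H1 : forall L, csum (fun _ => RtoC 1) L = RtoC (INR L)).
    { induction L as [|L IH]; [reflexivity|].
      simpl csum. rewrite IH, S_INR, RtoC_plus. reflexivity. }
    rewrite H1, <- RtoC_mult, mult_INR. simpl (INR 2). f_equal. field. lra.
  - rewrite ssum_expi by lia. ring.
Qed.

Lemma dft_inversion (n : nat) (u : Z -> C) (j0 : Z) : (1 <= n)%nat ->
  (- Z.of_nat n <= j0 < Z.of_nat n)%Z ->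
  ssum n (fun k => dft n u k * expi (PI * IZR k * IZR j0 / INR n))%C = u j0.
Proof.
  intros Hn Hj0. pose proof (lt_0_INR n ltac:(lia)) as HN.
  transitivity (ssum n (fun k => ssum n (fun j => u j * (RtoC (/ (2 * INR n)) *
     expi (PI * IZR k * IZR (j0 - j) / INR n))))%C).
  { apply ssum_ext. intros k _. unfold dft.
    rewrite <- ssum_scal_l, <- ssum_scal_r. apply ssum_ext. intros j _.
    replace (PI * IZR k * IZR (j0 - j) / INR n)
      with (- PI * IZR j * IZR k / INR n + PI * IZR k * IZR j0 / INR n)
      by (rewrite minus_IZR; field; lra).
    rewrite expi_plus. ring. }
  rewrite ssum_swap.
  rewrite (ssum_ext n _ (fun j => u j * if Z.eq_dec j j0 then RtoC 1 else RtoC 0)%C).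
  2:{ intros j Hj. rewrite ssum_scal_l, ssum_scal_l, mean_character by auto. reflexivity. }
  rewrite (ssum_single _ _ j0); auto.
  - destruct (Z.eq_dec j0 j0); [ring|congruence].
  - intros k Hk Hne. destruct (Z.eq_dec k j0); [congruence|ring].
Qed.

Lemma trig_expi (n : nat) (k0 : Z) (x : R) : (1 <= n)%nat ->
  (- Z.of_nat n <= k0 < Z.of_nat n)%Z ->
  trig n (fun j => expi (PI * IZR k0 * IZR j / INR n)) x = expi (PI * IZR k0 * x).
Proof.
  intros Hn Hk0. pose proof (lt_0_INR n ltac:(lia)) as HN. unfold trig.
  rewrite (ssum_ext n _ (fun k => (if Z.eq_dec k k0 then RtoC 1 else RtoC 0)
     * expi (PI * IZR k * x))%C).
  2:{ intros k Hk. f_equal. rewrite <- (mean_character n k0 k) by auto.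
      unfold dft. f_equal. apply ssum_ext. intros j _. rewrite <- expi_plus.
      f_equal. rewrite minus_IZR. field. lra. }
  rewrite (ssum_single _ _ k0); auto.
  - destruct (Z.eq_dec k0 k0); [ring|congruence].
  - intros k Hk Hne. destruct (Z.eq_dec k k0); [congruence|ring].
Qed.

(** Aliasing: on the grid an exponential of any frequency coincides with one
    of frequency in [- n <= k < n]. *)
Lemma Cmod_trig_expi (n : nat) (k : Z) (x : R) : (1 <= n)%nat ->
  Cmod (trig n (fun j => expi (PI * IZR k * IZR j / INR n)) x) = 1.
Proof.
  intros Hn. pose proof (lt_0_INR n ltac:(lia)) as HN.
  set (q := ((k + Z.of_nat n) / (2 * Z.of_nat n))%Z).
  set (k0 := ((k + Z.of_nat n) mod (2 * Z.of_nat n) - Z.of_nat n)%Z).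
  assert (Hk : k = (k0 + 2 * Z.of_nat n * q)%Z).
  { unfold k0, q. pose proof (Z.div_mod (k + Z.of_nat n) (2 * Z.of_nat n) ltac:(lia)). lia. }
  assert (Hk0 : (- Z.of_nat n <= k0 < Z.of_nat n)%Z).
  { pose proof (Z.mod_pos_bound (k + Z.of_nat n) (2 * Z.of_nat n) ltac:(lia)). lia. }
  rewrite (trig_ext n _ (fun j => expi (PI * IZR k0 * IZR j / INR n))).
  - rewrite trig_expi by auto. apply Cmod_expi.
  - intros j _. rewrite <- (expi_period (PI * IZR k0 * IZR j / INR n) (q * j)). f_equal.
    rewrite Hk, plus_IZR, !mult_IZR, <- INR_IZR_INZ. field. lra.
Qed.

(** * Decay of the coefficients *)

Definition zdelta (u : Z -> R) (j : Z) : R := u (j + 1)%Z - u j.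

Fixpoint zdiff (m : nat) (u : Z -> R) : Z -> R :=
  match m with
  | O => u
  | S m' => zdiff m' (zdelta u)
  end.

Definition zperiodic (N : nat) (u : Z -> R) : Prop :=
  forall j, u (j + 2 * Z.of_nat N)%Z = u j.

Lemma zdelta_periodic (N : nat) (u : Z -> R) : zperiodic N u -> zperiodic N (zdelta u).
Proof.
  intros H j. unfold zdelta. rewrite H, <- (H (j + 1)%Z). do 2 f_equal. lia.
Qed.

(** Summation by parts; without boundary terms, by periodicity. *)
Lemma dft_zdelta (N : nat) (u : Z -> R) (k : Z) : (1 <= N)%nat -> zperiodic N u ->
  dft N (fun j => RtoC (zdelta u j)) k
  = ((expi (PI * IZR k / INR N) - RtoC 1) * dft N (fun j => RtoC (u j)) k)%C.
Proof.
  intros HN Hu. pose proof (lt_0_INR N ltac:(lia)) as HN'.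
  set (g := fun j => (RtoC (u j) * expi (- PI * IZR j * IZR k / INR N))%C).
  assert (Hs : ssum N (fun j => g (j + 1)%Z) = ssum N g).
  { apply ssum_shift. unfold g.
    rewrite <- (Hu (- Z.of_nat N)%Z).
    replace (- Z.of_nat N + 2 * Z.of_nat N)%Z with (Z.of_nat N) by lia. f_equal.
    rewrite <- (expi_period _ k). f_equal.
    rewrite opp_IZR, <- INR_IZR_INZ. field. lra. }
  unfold dft. fold g.
  rewrite (ssum_ext N _ (fun j => expi (PI * IZR k / INR N) * g (j + 1)%Z + - RtoC 1 * g j)%C).
  2:{ intros j _. unfold g, zdelta. rewrite RtoC_minus.
      replace (expi (- PI * IZR j * IZR k / INR N))
        with (expi (PI * IZR k / INR N) * expi (- PI * IZR (j + 1) * IZR k / INR N))%C; [ring|].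
      rewrite <- expi_plus. f_equal. rewrite plus_IZR. field. lra. }
  rewrite ssum_plus, !ssum_scal_l, Hs. ring.
Qed.

Lemma dft_zdiff (N m : nat) (u : Z -> R) (k : Z) : (1 <= N)%nat -> zperiodic N u ->
  dft N (fun j => RtoC (zdiff m u j)) k
  = ((expi (PI * IZR k / INR N) - RtoC 1) ^ m * dft N (fun j => RtoC (u j)) k)%C.
Proof.
  intros HN. revert u. induction m as [|m IH]; intros u Hu; simpl zdiff.
  - simpl. ring.
  - rewrite IH, dft_zdelta by (auto using zdelta_periodic). simpl. ring.
Qed.

Lemma Cmod_dft_le (N : nat) (v : Z -> R) (k : Z) : (1 <= N)%nat ->
  Cmod (dft N (fun j => RtoC (v j)) k)
  <= / (2 * INR N) * rsum (fun i => Rabs (v (Z.of_nat i - Z.of_nat N)%Z)) (2 * N).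
Proof.
  intros HN. pose proof (lt_0_INR N ltac:(lia)) as HN'.
  assert (0 < / (2 * INR N)) by (apply Rinv_0_lt_compat; lra).
  unfold dft. rewrite Cmod_mult, Cmod_R, (Rabs_pos_eq (/ _)) by lra.
  apply Rmult_le_compat_l; [lra|].
  eapply Rle_trans; [apply csum_mod|].
  apply rsum_le. intros i _. rewrite Cmod_mult, Cmod_expi, Cmod_R. lra.
Qed.

(** Summation by parts [m] times multiplies the coefficient by
    [(expi (PI k / N) - 1) ^ m], whose modulus is at least [(|k| / N) ^ m]. *)
Lemma dft_decay (N s : nat) (u : Z -> R) (K : R) (k : Z) : (1 <= N)%nat -> zperiodic N u ->
  rsum (fun i => Rabs (zdiff (s + 2) u (Z.of_nat i - Z.of_nat N)%Z)) (2 * N)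
    <= K / INR N ^ (s + 1) ->
  (k <> 0)%Z -> (Z.abs k <= Z.of_nat N)%Z ->
  Cmod (dft N (fun j => RtoC (u j)) k) <= K / Rabs (IZR k) ^ (s + 2).
Proof.
  intros HN Hu HV Hk0 Hk. pose proof (lt_0_INR N ltac:(lia)) as HN'.
  assert (Hk1 : 0 < Rabs (IZR k)) by (apply Rabs_pos_lt; intros E; apply Hk0, eq_IZR; auto).
  assert (Hk2 : Rabs (IZR k) <= INR N).
  { rewrite <- abs_IZR, INR_IZR_INZ. apply IZR_le. auto. }
  set (c := Cmod (dft N (fun j => RtoC (u j)) k)).
  assert (Hc : 0 <= c) by apply Cmod_ge_0.
  assert (H1 : (Rabs (IZR k) / INR N) ^ (s + 2) * c <= / (2 * INR N) * (K / INR N ^ (s + 1))).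
  { eapply Rle_trans; [|apply Rmult_le_compat_l; [|exact HV]].
    2:{ left. apply Rinv_0_lt_compat. lra. }
    eapply Rle_trans; [|apply Cmod_dft_le with (k := k); auto].
    rewrite dft_zdiff, Cmod_mult, Cmod_pow by auto. fold c.
    apply Rmult_le_compat_r; auto. apply pow_incr. split.
    - apply Rdiv_le_0_compat; lra.
    - pose proof PI2_3_2. pose proof PI_RGT_0.
      assert (E : Rabs (PI * IZR k / INR N) = PI * (Rabs (IZR k) / INR N)).
      { unfold Rdiv. rewrite !Rabs_mult, (Rabs_pos_eq PI), (Rabs_pos_eq (/ _)); try lra.
        left. apply Rinv_0_lt_compat. auto. }
      assert (0 < Rabs (IZR k) / INR N) by (apply Rdiv_lt_0_compat; lra).
      assert (Rabs (IZR k) / INR N <= 1) by (apply Rle_div_l; lra).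
      pose proof (Cmod_expi_sub_1_ge (PI * IZR k / INR N)) as H'. rewrite E in H'.
      specialize (H' ltac:(nra)). nra. }
  assert (HK : 0 <= K).
  { assert (0 < (Rabs (IZR k) / INR N) ^ (s + 2)) by (apply pow_lt, Rdiv_lt_0_compat; lra).
    assert (0 <= / (2 * INR N) * (K / INR N ^ (s + 1))) by nra.
    assert (0 < / (2 * INR N) * / INR N ^ (s + 1)).
    { apply Rmult_lt_0_compat; apply Rinv_0_lt_compat; [lra|apply pow_lt; auto]. }
    unfold Rdiv in *. nra. }
  assert (Hp : 0 < Rabs (IZR k) ^ (s + 2)) by (apply pow_lt; auto).
  assert (HpN : 0 < INR N ^ (s + 1)) by (apply pow_lt; auto).
  unfold Rdiv in H1. rewrite Rpow_mult_distr, pow_inv in H1.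
  replace (INR N ^ (s + 2)) with (INR N * INR N ^ (s + 1)) in H1
    by (replace (s + 2)%nat with (S (s + 1)) by lia; reflexivity).
  apply (Rmult_le_compat_l (INR N * INR N ^ (s + 1))) in H1; [|nra].
  replace (INR N * INR N ^ (s + 1) *
    (Rabs (IZR k) ^ (s + 2) * / (INR N * INR N ^ (s + 1)) * c))
    with (c * Rabs (IZR k) ^ (s + 2)) in H1 by (field; split; lra).
  replace (INR N * INR N ^ (s + 1) * (/ (2 * INR N) * (K * / INR N ^ (s + 1))))
    with (K / 2) in H1 by (field; split; lra).
  apply Rle_div_r; lra.
Qed.

(** * Interpolation error on a finer grid *)

Lemma rsum_telescope (b T : nat -> R) (L : nat) :
  (forall i, (i < L)%nat -> b i <= T (S i) - T i) -> rsum b L <= T L - T 0%nat.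
Proof.
  induction L as [|L IH]; intros H; simpl; [lra|].
  assert (rsum b L <= T L - T 0%nat) by auto. specialize (H L ltac:(lia)). lra.
Qed.

(** Comparison of [1 / y^2] with [1 / (y^2 - 1/4)], whose sum telescopes; it
    serves the negative and the positive frequencies alike. *)
Lemma inv_square_telescope (y : R) : 1 <= Rabs y ->
  / y ^ 2 <= - / (y + 1 - 1 / 2) - - / (y - 1 / 2).
Proof.
  intros Hy.
  assert (Hy2 : 1 <= y * y).
  { rewrite <- (Rabs_pos_eq (y * y)) by nra. rewrite Rabs_mult. nra. }
  assert (Ha : y + 1 - 1 / 2 <> 0) by (intros E; assert (y = - (1/2)) by lra; subst; lra).
  assert (Hb : y - 1 / 2 <> 0) by (intros E; assert (y = 1/2) by lra; subst; lra).
  assert (y <> 0) by (intros E; subst; lra).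
  replace (- / (y + 1 - 1 / 2) - - / (y - 1 / 2)) with (/ (y * y - 1 / 4)).
  - replace (y ^ 2) with (y * y) by ring. apply Rinv_le_contravar; lra.
  - replace (y * y - 1 / 4) with ((y + 1 - 1 / 2) * (y - 1 / 2)) by field. field.
    split; intros E; first [apply Ha; lra | apply Hb; lra].
Qed.

Lemma rsum_tail (n N : nat) (K : R) (b : nat -> R) : (1 <= n <= N)%nat -> 0 <= K ->
  (forall i, (i < 2 * N)%nat ->
     let k := (Z.of_nat i - Z.of_nat N)%Z in
     b i <= if Z_le_dec (- Z.of_nat n) k
            then if Z_lt_dec k (Z.of_nat n) then 0 else K / IZR k ^ 2
            else K / IZR k ^ 2) ->
  rsum b (2 * N) <= 4 * K / INR n.
Proof.
  intros Hn HK Hb. pose proof (le_INR 1 n ltac:(lia)) as Hn1. simpl (INR 1) in Hn1.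
  pose proof (le_INR n N ltac:(lia)) as HnN.
  replace (2 * N)%nat with ((N - n) + 2 * n + (N - n))%nat by lia.
  rewrite !rsum_cat. cbv zeta in Hb.
  assert (Hstep : forall z : Z, (1 <= Z.abs z)%Z ->
     K / IZR z ^ 2 <= K * - / (IZR (z + 1) - 1 / 2) - K * - / (IZR z - 1 / 2)).
  { intros z Hz. rewrite plus_IZR.
    apply Rle_trans with (K * (- / (IZR z + 1 - 1 / 2) - - / (IZR z - 1 / 2))); [|lra].
    apply Rmult_le_compat_l; auto. apply inv_square_telescope.
    rewrite <- abs_IZR. apply IZR_le. auto. }
  assert (H1 : rsum b (N - n) <= K / INR n).
  { eapply Rle_trans.
    - apply (rsum_telescope b (fun i => K * - / (IZR (Z.of_nat i - Z.of_nat N) - 1 / 2))).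
      intros i Hi. specialize (Hb i ltac:(lia)).
      destruct (Z_le_dec (- Z.of_nat n) (Z.of_nat i - Z.of_nat N)); [lia|].
      eapply Rle_trans; [exact Hb|].
      replace (Z.of_nat (S i) - Z.of_nat N)%Z with (Z.of_nat i - Z.of_nat N + 1)%Z by lia.
      apply Hstep. lia.
    - replace (Z.of_nat (N - n) - Z.of_nat N)%Z with (- Z.of_nat n)%Z by lia.
      replace (Z.of_nat 0 - Z.of_nat N)%Z with (- Z.of_nat N)%Z by lia.
      rewrite !opp_IZR, <- !INR_IZR_INZ.
      replace (- / (- INR n - 1 / 2)) with (/ (INR n + 1 / 2)) by (field; split; lra).
      replace (- / (- INR N - 1 / 2)) with (/ (INR N + 1 / 2)) by (field; split; lra).
      assert (0 < / (INR N + 1 / 2)) by (apply Rinv_0_lt_compat; lra).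
      assert (/ (INR n + 1 / 2) <= / INR n) by (apply Rinv_le_contravar; lra).
      unfold Rdiv. nra. }
  assert (H2 : rsum (fun i => b (N - n + i)%nat) (2 * n) <= 0).
  { apply Rle_trans with (rsum (fun _ => 0) (2 * n)); [|rewrite rsum_const; lra].
    apply rsum_le. intros i Hi. specialize (Hb (N - n + i)%nat ltac:(lia)).
    destruct (Z_le_dec (- Z.of_nat n) (Z.of_nat (N - n + i) - Z.of_nat N)); [|lia].
    destruct (Z_lt_dec (Z.of_nat (N - n + i) - Z.of_nat N) (Z.of_nat n)); [|lia].
    exact Hb. }
  assert (H3 : rsum (fun i => b (N - n + 2 * n + i)%nat) (N - n) <= 2 * K / INR n).
  { eapply Rle_trans.
    - apply (rsum_telescope _ (fun i => K * - / (IZR (Z.of_nat i + Z.of_nat n) - 1 / 2))).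
      intros i Hi. specialize (Hb (N - n + 2 * n + i)%nat ltac:(lia)).
      destruct (Z_lt_dec (Z.of_nat (N - n + 2 * n + i) - Z.of_nat N) (Z.of_nat n)); [lia|].
      destruct (Z_le_dec (- Z.of_nat n) (Z.of_nat (N - n + 2 * n + i) - Z.of_nat N)); [|lia].
      eapply Rle_trans; [exact Hb|].
      replace (Z.of_nat (N - n + 2 * n + i) - Z.of_nat N)%Z
        with (Z.of_nat i + Z.of_nat n)%Z by lia.
      replace (Z.of_nat (S i) + Z.of_nat n)%Z with (Z.of_nat i + Z.of_nat n + 1)%Z by lia.
      apply Hstep. lia.
    - replace (Z.of_nat (N - n) + Z.of_nat n)%Z with (Z.of_nat N)%Z by lia.
      replace (Z.of_nat 0 + Z.of_nat n)%Z with (Z.of_nat n)%Z by lia.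
      rewrite <- !INR_IZR_INZ.
      assert (0 < / (INR N - 1 / 2)) by (apply Rinv_0_lt_compat; lra).
      assert (/ (INR n - 1 / 2) <= 2 / INR n).
      { replace (2 / INR n) with (/ (INR n / 2)) by (field; lra).
        apply Rinv_le_contravar; lra. }
      unfold Rdiv in *. nra. }
  assert (0 <= K / INR n) by (apply Rdiv_le_0_compat; lra).
  unfold Rdiv in *. lra.
Qed.

(** On the grid of step [1 / (n M)] the sequence [u] is a trigonometric sum by
    inversion; interpolation on the coarse grid of step [1 / n] reproduces its
    terms of frequency in [- n <= k < n] and the other ones are small.  The
    bound does not depend on [M]. *)
Lemma trig_error_fine_grid (n M s : nat) (u : Z -> R) (K : R) (j0 : Z) :
  (1 <= n)%nat -> (1 <= M)%nat -> zperiodic (n * M) u -> 0 <= K ->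
  rsum (fun i => Rabs (zdiff (s + 2) u (Z.of_nat i - Z.of_nat (n * M))%Z)) (2 * (n * M))
    <= K / INR (n * M) ^ (s + 1) ->
  (- Z.of_nat (n * M) <= j0 < Z.of_nat (n * M))%Z ->
  Cmod (trig n (fun j => RtoC (u (j * Z.of_nat M)%Z)) (IZR j0 / INR (n * M)) - RtoC (u j0))
    <= 8 * K / INR n ^ (s + 1).
Proof.
  intros Hn HM Hu HK HV Hj0.
  set (N := (n * M)%nat) in *.
  assert (HnN : (n <= N)%nat) by (unfold N; nia).
  pose proof (lt_0_INR n ltac:(lia)) as Hn'.
  pose proof (lt_0_INR M ltac:(lia)) as HM'.
  assert (HNR : INR N = INR n * INR M) by apply mult_INR.
  set (x := IZR j0 / INR N).
  set (c := dft N (fun j => RtoC (u j))).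
  set (e := fun k => trig n (fun j => expi (PI * IZR k * IZR j / INR n)) x).
  assert (E1 : trig n (fun j => RtoC (u (j * Z.of_nat M)%Z)) x = ssum N (fun k => c k * e k)%C).
  { rewrite (trig_ext n _ (fun j => ssum N (fun k => c k * expi (PI * IZR k * IZR j / INR n))%C)).
    - unfold ssum at 1. rewrite trig_csum. apply csum_ext. intros i _. apply trig_scal.
    - intros j Hj. rewrite <- (dft_inversion N (fun j => RtoC (u j))) by (unfold N in *; nia).
      apply ssum_ext. intros k _. unfold c. do 2 f_equal.
      rewrite mult_IZR, <- INR_IZR_INZ, HNR. field. lra. }
  assert (E2 : RtoC (u j0) = ssum N (fun k => c k * expi (PI * IZR k * x))%C).
  { rewrite <- (dft_inversion N (fun j => RtoC (u j))) by lia.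
    apply ssum_ext. intros k _. unfold c. do 2 f_equal. unfold x. field. nra. }
  rewrite E1, E2.
  replace (ssum N (fun k => c k * e k)%C - ssum N (fun k => c k * expi (PI * IZR k * x))%C)%C
    with (ssum N (fun k => c k * (e k - expi (PI * IZR k * x))))%C.
  2:{ rewrite (ssum_ext N _ (fun k => c k * e k + - RtoC 1 * (c k * expi (PI * IZR k * x)))%C)
        by (intros; ring).
      rewrite ssum_plus, ssum_scal_l. ring. }
  unfold ssum. eapply Rle_trans; [apply csum_mod|].
  (* of the [s + 2] powers of [k], [s] are bounded by those of [n] and the other
     two make the tail summable *)
  replace (8 * K / INR n ^ (s + 1)) with (4 * (2 * K / INR n ^ s) / INR n)
    by (rewrite pow_add; field; split; [lra|apply pow_nonzero; lra]).
  assert (Hns : 0 < INR n ^ s) by (apply pow_lt; auto).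
  apply rsum_tail; [lia|apply Rdiv_le_0_compat; lra|].
  intros i Hi k. fold k.
  assert (Hbig : (Z.of_nat n <= Z.abs k)%Z ->
     Cmod (c k * (e k - expi (PI * IZR k * x))) <= 2 * K / INR n ^ s / IZR k ^ 2).
  { intros Hk. rewrite Cmod_mult.
    assert (H1 : Cmod (e k - expi (PI * IZR k * x)) <= 2).
    { eapply Rle_trans; [apply Cmod_triangle|]. unfold e.
      rewrite Cmod_opp, Cmod_trig_expi, Cmod_expi by auto. lra. }
    pose proof (dft_decay N s u K k ltac:(lia) Hu HV ltac:(lia) ltac:(lia)) as H2.
    fold c in H2.
    assert (Hkn : INR n <= Rabs (IZR k)).
    { rewrite <- abs_IZR, INR_IZR_INZ. apply IZR_le. auto. }
    assert (H3 : K / Rabs (IZR k) ^ (s + 2) <= K / INR n ^ s / IZR k ^ 2).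
    { rewrite pow_add, pow2_abs.
      assert (0 < IZR k ^ 2) by (rewrite <- pow2_abs; apply pow_lt; lra).
      unfold Rdiv. rewrite Rinv_mult, <- Rmult_assoc.
      apply Rmult_le_compat_r; [left; apply Rinv_0_lt_compat; auto|].
      apply Rmult_le_compat_l; auto.
      apply Rinv_le_contravar; auto. apply pow_incr. lra. }
    pose proof (Cmod_ge_0 (c k)). pose proof (Cmod_ge_0 (e k - expi (PI * IZR k * x))).
    replace (2 * K / INR n ^ s / IZR k ^ 2) with (K / INR n ^ s / IZR k ^ 2 * 2)
      by (unfold Rdiv; ring).
    apply Rmult_le_compat; lra. }
  destruct (Z_le_dec (- Z.of_nat n) k) as [Hk1|Hk1]; [|apply Hbig; lia].
  destruct (Z_lt_dec k (Z.of_nat n)) as [Hk2|Hk2]; [|apply Hbig; lia].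
  unfold e. rewrite trig_expi by lia.
  replace (c k * _)%C with (RtoC 0) by ring. rewrite Cmod_0. lra.
Qed.

(** Interpolants are continuous; the constant depends on [n], which is fixed
    when the fine grid is refined. *)
Lemma trig_lipschitz (n : nat) (v : Z -> C) :
  exists L, 0 <= L /\ forall x y, Cmod (trig n v x - trig n v y) <= L * Rabs (x - y).
Proof.
  unfold trig, ssum. generalize (2 * n)%nat. intros m.
  induction m as [|m [L [HL IH]]].
  - exists 0. split; [lra|]. intros x y. simpl.
    replace (RtoC 0 - RtoC 0)%C with (RtoC 0) by ring. rewrite Cmod_0. lra.
  - set (k := (Z.of_nat m - Z.of_nat n)%Z).
    exists (L + Cmod (dft n v k) * (PI * Rabs (IZR k))).
    pose proof (Cmod_ge_0 (dft n v k)). pose proof (Rabs_pos (IZR k)). pose proof PI_RGT_0.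
    split; [apply Rplus_le_le_0_compat; auto; apply Rmult_le_pos; nra|].
    intros x y. simpl csum. fold k. specialize (IH x y).
    match goal with |- Cmod ?t <= _ => replace t with
      ((csum (fun i => dft n v (Z.of_nat i - Z.of_nat n) *
                        expi (PI * IZR (Z.of_nat i - Z.of_nat n) * x)) m -
        csum (fun i => dft n v (Z.of_nat i - Z.of_nat n) *
                        expi (PI * IZR (Z.of_nat i - Z.of_nat n) * y)) m) +
       dft n v k * (expi (PI * IZR k * x) - expi (PI * IZR k * y)))%C by ring end.
    eapply Rle_trans; [apply Cmod_triangle|]. rewrite Cmod_mult.
    pose proof (Cmod_expi_sub_le (PI * IZR k * x) (PI * IZR k * y)) as H2.
    replace (PI * IZR k * x - PI * IZR k * y) with (PI * IZR k * (x - y)) in H2 by ring.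
    rewrite !Rabs_mult, (Rabs_pos_eq PI) in H2 by lra.
    apply (Rmult_le_compat_l (Cmod (dft n v k))) in H2; auto. lra.
Qed.

(** * Finite differences *)

Fixpoint fdiff (m : nat) (h : R) (g : R -> R) (x : R) : R :=
  match m with
  | O => g x
  | S m' => fdiff m' h (fun y => g (y + h) - g y) x
  end.

Lemma fdiff_ext (m : nat) (h : R) (g g' : R -> R) (x : R) :
  (forall y, g y = g' y) -> fdiff m h g x = fdiff m h g' x.
Proof.
  revert g g'. induction m as [|m IH]; intros g g' H; simpl; auto.
  apply IH. intros y. rewrite !H. reflexivity.
Qed.

Lemma fdiff_plus (m : nat) (h : R) (g g' : R -> R) (x : R) :
  fdiff m h (fun y => g y + g' y) x = fdiff m h g x + fdiff m h g' x.
Proof.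
  revert g g'. induction m as [|m IH]; intros g g'; simpl; auto.
  rewrite <- IH. apply fdiff_ext. intros y. ring.
Qed.

Lemma fdiff_scal (m : nat) (h c : R) (g : R -> R) (x : R) :
  fdiff m h (fun y => c * g y) x = c * fdiff m h g x.
Proof.
  revert g. induction m as [|m IH]; intros g; simpl; auto.
  rewrite <- IH. apply fdiff_ext. intros y. ring.
Qed.

Lemma fdiff_shift (m : nat) (h a : R) (g : R -> R) (x : R) :
  fdiff m h (fun y => g (y + a)) x = fdiff m h g (x + a).
Proof.
  revert g. induction m as [|m IH]; intros g; simpl; auto.
  rewrite <- IH. apply fdiff_ext. intros y. do 2 f_equal. ring.
Qed.

(** The discrete Leibniz rule, for one factor equal to the identity. *)
Lemma fdiff_mul_id (m : nat) (h : R) (g : R -> R) (x : R) :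
  fdiff m h (fun y => y * g y) x
  = x * fdiff m h g x + INR m * h * fdiff (pred m) h g (x + h).
Proof.
  revert g. induction m as [|m IH]; intros g; [simpl; ring|].
  simpl fdiff at 1.
  rewrite (fdiff_ext m h _ (fun y => y * (g (y + h) - g y) + h * g (y + h)))
    by (intros; ring).
  rewrite fdiff_plus, fdiff_scal, fdiff_shift, IH, S_INR. simpl pred.
  destruct m as [|m]; simpl; ring.
Qed.

(** Only the values on the stencil of [j] enter, so that [g] may be any function
    that approximates the sequence there. *)
Lemma zdiff_near (m N : nat) (u : Z -> R) (g : R -> R) (j : Z) (E : R) : (1 <= N)%nat ->
  (forall i, (0 <= i <= Z.of_nat m)%Z -> Rabs (u (j + i)%Z - g (IZR (j + i) / INR N)) <= E) ->
  Rabs (zdiff m u j) <= Rabs (fdiff m (/ INR N) g (IZR j / INR N)) + 2 ^ m * E.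
Proof.
  intros HN. pose proof (lt_0_INR N ltac:(lia)) as HN'.
  revert u g E. induction m as [|m IH]; intros u g E H; cbn [zdiff fdiff pow].
  - specialize (H 0%Z ltac:(lia)). rewrite Z.add_0_r in H.
    pose proof (Rabs_triang (u j - g (IZR j / INR N)) (g (IZR j / INR N))) as T.
    replace (u j - g (IZR j / INR N) + g (IZR j / INR N)) with (u j) in T by ring. lra.
  - replace (2 * 2 ^ m * E) with (2 ^ m * (2 * E)) by ring. apply IH.
    intros i Hi. unfold zdelta.
    replace (IZR (j + i) / INR N + / INR N) with (IZR (j + (i + 1)) / INR N)
      by (rewrite !plus_IZR; field; lra).
    replace (j + i + 1)%Z with (j + (i + 1))%Z by lia.
    pose proof (H (i + 1)%Z ltac:(lia)) as H1. pose proof (H i ltac:(lia)) as H2.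
    match goal with |- Rabs (?a - ?b - (?c - ?d)) <= _ =>
      replace (a - b - (c - d)) with ((a - c) - (b - d)) by ring end.
    eapply Rle_trans; [apply Rabs_triang|]. rewrite Rabs_Ropp. lra.
Qed.

(** [C^oo] regularity as the grids see it, locally uniformly.  This is how
    the smoothness of the polynomials enters; the closure properties below
    replace the computation of their derivatives. *)
Definition diff_smooth (g : R -> R) : Prop :=
  forall (m : nat) (A : R), exists C, 0 <= C /\
    forall x h, Rabs x <= A -> 0 <= h <= 1 -> Rabs (fdiff m h g x) <= C * h ^ m.

Lemma diff_smooth_ext (g g' : R -> R) :
  (forall y, g y = g' y) -> diff_smooth g -> diff_smooth g'.
Proof.
  intros E H m A. destruct (H m A) as [C [HC HB]]. exists C. split; auto.
  intros x h Hx Hh. rewrite <- (fdiff_ext m h g g' x E). auto.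
Qed.

Lemma diff_smooth_plus (g g' : R -> R) :
  diff_smooth g -> diff_smooth g' -> diff_smooth (fun y => g y + g' y).
Proof.
  intros H H' m A. destruct (H m A) as [C [HC HB]]. destruct (H' m A) as [C' [HC' HB']].
  exists (C + C'). split; [lra|]. intros x h Hx Hh. rewrite fdiff_plus.
  eapply Rle_trans; [apply Rabs_triang|].
  specialize (HB x h Hx Hh). specialize (HB' x h Hx Hh). lra.
Qed.

Lemma diff_smooth_scal (c : R) (g : R -> R) :
  diff_smooth g -> diff_smooth (fun y => c * g y).
Proof.
  intros H m A. destruct (H m A) as [C [HC HB]].
  exists (Rabs c * C). split; [apply Rmult_le_pos; auto using Rabs_pos|].
  intros x h Hx Hh. rewrite fdiff_scal, Rabs_mult, Rmult_assoc.
  apply Rmult_le_compat_l; auto using Rabs_pos.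
Qed.

Lemma diff_smooth_const (c : R) : diff_smooth (fun _ => c).
Proof.
  intros m A. exists (Rabs c). split; [apply Rabs_pos|]. intros x h _ Hh.
  destruct m as [|m]; simpl; [lra|].
  rewrite (fdiff_ext m h _ (fun _ => 0 * 0)) by (intros; ring).
  rewrite (fdiff_scal m h 0 (fun _ => 0)), Rmult_0_l, Rabs_R0.
  apply Rmult_le_pos; [apply Rabs_pos|]. apply Rmult_le_pos; [lra|apply pow_le; lra].
Qed.

Lemma diff_smooth_mul_id (g : R -> R) :
  diff_smooth g -> diff_smooth (fun y => y * g y).
Proof.
  intros H m A. destruct (H m A) as [C [HC HB]].
  destruct (H (pred m) (A + 1)) as [C' [HC' HB']].
  exists (Rabs A * C + INR m * C'). pose proof (pos_INR m) as Hm.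
  split; [apply Rplus_le_le_0_compat; apply Rmult_le_pos; auto using Rabs_pos|].
  intros x h Hx Hh. rewrite fdiff_mul_id.
  assert (HA : Rabs x <= Rabs A) by (eapply Rle_trans; [exact Hx|apply Rle_abs]).
  eapply Rle_trans; [apply Rabs_triang|]. rewrite Rmult_plus_distr_r.
  apply Rplus_le_compat.
  - rewrite Rabs_mult, Rmult_assoc.
    apply Rmult_le_compat; auto using Rabs_pos.
  - assert (Hxh : Rabs (x + h) <= A + 1).
    { eapply Rle_trans; [apply Rabs_triang|]. rewrite (Rabs_pos_eq h) by lra. lra. }
    specialize (HB' (x + h) h Hxh Hh).
    rewrite Rabs_mult, Rabs_pos_eq by (apply Rmult_le_pos; lra).
    destruct m as [|m]; [simpl (INR 0); lra|]. simpl pred in *.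
    replace (INR (S m) * C' * h ^ S m) with (INR (S m) * h * (C' * h ^ m)) by (simpl pow; ring).
    apply Rmult_le_compat_l; auto. apply Rmult_le_pos; lra.
Qed.

Lemma diff_smooth_sum_n (g : nat -> R -> R) (n : nat) :
  (forall i, diff_smooth (g i)) -> diff_smooth (fun y => sum_n (fun i => g i y) n).
Proof.
  intros H. induction n as [|n IH].
  - apply diff_smooth_ext with (g 0%nat); auto. intros y. rewrite sum_O. reflexivity.
  - apply diff_smooth_ext with (fun y => sum_n (fun i => g i y) n + g (S n) y).
    + intros y. rewrite sum_Sn. reflexivity.
    + apply diff_smooth_plus; auto.
Qed.

Lemma diff_smooth_mul_affine (c : R) (g : R -> R) (k : nat) :
  diff_smooth g -> diff_smooth (fun y => (c + y) ^ k * g y).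
Proof.
  intros H. induction k as [|k IH].
  - apply diff_smooth_ext with g; auto. intros y. simpl. ring.
  - apply diff_smooth_ext with
      (fun y => c * ((c + y) ^ k * g y) + y * ((c + y) ^ k * g y)).
    + intros y. simpl. ring.
    + apply diff_smooth_plus; auto using diff_smooth_scal, diff_smooth_mul_id.
Qed.

(** * Sums with few exceptional terms *)

Lemma rsum_window (t w : R) (L : nat) : 0 <= w ->
  rsum (fun i => if Rle_dec (INR i) t then if Rle_dec t (INR i + w) then 1 else 0 else 0) L
  <= w + 1.
Proof.
  intros Hw.
  (* the increments of the clamped function [i |-> min (w + 1) (i - t + w)^+] *)
  set (T := fun i : nat => Rmax 0 (Rmin (w + 1) (INR i - (t - w)))).
  eapply Rle_trans; [apply (rsum_telescope _ T)|].
  - intros i _. unfold T. rewrite S_INR.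
    unfold Rmin. destruct (Rle_dec (w + 1) (INR i + 1 - (t - w)));
      destruct (Rle_dec (w + 1) (INR i - (t - w)));
      unfold Rmax; repeat match goal with |- context [Rle_dec ?a ?b] => destruct (Rle_dec a b) end;
      lra.
  - assert (HT : forall i, 0 <= T i <= w + 1).
    { intros i. unfold T. split; [apply Rmax_l|].
      apply Rmax_lub; [lra|apply Rmin_l]. }
    pose proof (HT L). pose proof (HT 0%nat). lra.
Qed.

(** Each exceptional point [t] spoils at most [w + 1] terms, for which the weaker
    bound [D] is used in place of [d]. *)
Lemma rsum_exceptional (B : list R) (w d D : R) (L : nat) (v : nat -> R) :
  0 <= w -> 0 <= d -> 0 <= D ->
  (forall i, (i < L)%nat -> v i <= D) ->
  (forall i, (i < L)%nat -> (forall t, In t B -> ~ (INR i <= t <= INR i + w)) -> v i <= d) ->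
  rsum v L <= INR L * d + D * (INR (length B) * (w + 1)).
Proof.
  intros Hw Hd HD. revert v. induction B as [|t B IH]; intros v H1 H2.
  - simpl. rewrite Rmult_0_l, Rmult_0_r, Rplus_0_r, <- rsum_const.
    apply rsum_le. intros i Hi. apply H2; auto.
  - set (ind := fun i => if Rle_dec (INR i) t then if Rle_dec t (INR i + w)
                         then 1 else 0 else 0).
    apply Rle_trans with (rsum (fun i => (if Req_EM_T (ind i) 1 then 0 else v i) + D * ind i) L).
    { apply rsum_le. intros i Hi. specialize (H1 i Hi).
      destruct (Req_EM_T (ind i) 1) as [E|E]; [rewrite E; lra|].
      assert (0 <= ind i).
      { unfold ind. destruct (Rle_dec (INR i) t); [|lra].
        destruct (Rle_dec t (INR i + w)); lra. }
      nra. }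
    rewrite rsum_plus, rsum_scal_l.
    pose proof (rsum_window t w L Hw) as HW. fold ind in HW.
    assert (HI : rsum (fun i => if Req_EM_T (ind i) 1 then 0 else v i) L
                 <= INR L * d + D * (INR (length B) * (w + 1))).
    { apply IH.
      - intros i Hi. destruct (Req_EM_T (ind i) 1); auto.
      - intros i Hi Hno. destruct (Req_EM_T (ind i) 1) as [E|E]; auto.
        apply H2; auto. intros t' [<-|Ht']; auto. intros [Ha Hb]. apply E.
        unfold ind. destruct (Rle_dec (INR i) t); [|lra].
        destruct (Rle_dec t (INR i + w)); lra. }
    apply (Rmult_le_compat_l D) in HW; auto.
    cbn [length]. rewrite S_INR. lra.
Qed.

(** * Interpolation of a continuation *)

(** The grid values of [f] on [[0, 1]] and of [P] to the left of [0]. *)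
Definition glue (f P : R -> R) (n : nat) (j : Z) : R :=
  if (0 <=? j)%Z then f (IZR j / INR n) else P (IZR j / INR n).

(** The trace on grids of [C^s] and piecewise [C^(s+2)] regularity on [[0, 1]],
    with break points [B]. *)
Definition diff_piecewise (s : nat) (f : R -> R) : Prop :=
  exists (B : list R) (C : R), 0 <= C /\
    forall (N : nat) (j : Z), (1 <= N)%nat -> (0 <= j)%Z ->
      (j + Z.of_nat (s + 2) <= Z.of_nat N)%Z ->
      Rabs (fdiff (s + 2) (/ INR N) f (IZR j / INR N)) <= C / INR N ^ (s + 1) /\
      ((forall b, In b B -> ~ (IZR j / INR N <= b <= IZR (j + Z.of_nat (s + 2)) / INR N)) ->
       Rabs (fdiff (s + 2) (/ INR N) f (IZR j / INR N)) <= C / INR N ^ (s + 2)).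

(** Contact of order [s] of [f] with [P] at [0], and with the translate of [P]
    at [1]. *)
Definition contact (s : nat) (f P : R -> R) : Prop :=
  exists C, 0 <= C /\ forall y, 0 <= y <= 1 ->
    Rabs (f y - P y) <= C * y ^ (s + 1) /\
    Rabs (f (1 - y) - P (-1 - y)) <= C * y ^ (s + 1).

(** Reduction of the index to [- N <= j < N]. *)
Definition periodized (f P : R -> R) (N : nat) (j : Z) : R :=
  glue f P N ((j + Z.of_nat N) mod (2 * Z.of_nat N) - Z.of_nat N).

Lemma periodized_periodic (f P : R -> R) (N : nat) : (1 <= N)%nat ->
  zperiodic N (periodized f P N).
Proof.
  intros HN j. unfold periodized. f_equal. f_equal.
  replace (j + 2 * Z.of_nat N + Z.of_nat N)%Z
    with (j + Z.of_nat N + 1 * (2 * Z.of_nat N))%Z by lia.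
  apply Z_mod_plus_full.
Qed.

Lemma periodized_base (f P : R -> R) (N : nat) (j : Z) : (1 <= N)%nat ->
  (- Z.of_nat N <= j < Z.of_nat N)%Z -> periodized f P N j = glue f P N j.
Proof.
  intros HN Hj. unfold periodized. rewrite Z.mod_small by lia. f_equal. lia.
Qed.

Lemma contact_0 (s : nat) (f P : R -> R) : contact s f P -> f 0 = P 0 /\ f 1 = P (-1).
Proof.
  intros [C [HC H]]. destruct (H 0 ltac:(lra)) as [H0 H1].
  rewrite pow_i, Rmult_0_r in H0, H1 by lia.
  rewrite !Rminus_0_r in H1.
  pose proof (Rabs_pos (f 0 - P 0)). pose proof (Rabs_pos (f 1 - P (-1))).
  split; apply Rminus_diag_uniq, Rabs_eq_0; lra.
Qed.

Lemma periodized_left (f P : R -> R) (s N : nat) (j : Z) : contact s f P -> (1 <= N)%nat ->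
  (- Z.of_nat N <= j <= 0)%Z -> periodized f P N j = P (IZR j / INR N).
Proof.
  intros Hc HN Hj. rewrite periodized_base by lia. unfold glue.
  destruct (Z.leb_spec 0 j) as [H|H]; auto.
  replace j with 0%Z by lia. unfold Rdiv. rewrite Rmult_0_l. apply (contact_0 s f P Hc).
Qed.

Lemma periodized_middle (f P : R -> R) (s N : nat) (j : Z) : contact s f P -> (1 <= N)%nat ->
  (0 <= j <= Z.of_nat N)%Z -> periodized f P N j = f (IZR j / INR N).
Proof.
  intros Hc HN Hj. pose proof (lt_0_INR N ltac:(lia)) as HN'.
  destruct (Z.eq_dec j (Z.of_nat N)) as [->|Hne].
    replace (Z.of_nat N) with (- Z.of_nat N + 2 * Z.of_nat N)%Z at 1 by lia.
    rewrite (periodized_periodic f P N HN), (periodized_left f P s N) by (auto; lia).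
    rewrite opp_IZR, <- INR_IZR_INZ.
    replace (- INR N / INR N) with (-1) by (field; lra).
    replace (INR N / INR N) with 1 by (field; lra).
    symmetry. apply (contact_0 s f P Hc).
  - rewrite periodized_base by lia. unfold glue.
    destruct (Z.leb_spec 0 j) as [H|H]; [reflexivity|lia].
Qed.

Lemma periodized_right (f P : R -> R) (s N : nat) (j : Z) : contact s f P -> (1 <= N)%nat ->
  (Z.of_nat N <= j <= 2 * Z.of_nat N)%Z -> periodized f P N j = P (IZR j / INR N + -2).
Proof.
  intros Hc HN Hj. pose proof (lt_0_INR N ltac:(lia)) as HN'.
  replace j with (j - 2 * Z.of_nat N + 2 * Z.of_nat N)%Z at 1 by lia.
  rewrite (periodized_periodic f P N HN), (periodized_left f P s N) by (auto; lia).
  f_equal. rewrite minus_IZR, mult_IZR, <- INR_IZR_INZ. field. lra.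
Qed.

(** On a stencil with nodes on both sides of a junction the continuation is [P]
    (or its translate) up to the contact error. *)
Lemma periodized_zdiff (s : nat) (f P : R -> R) :
  diff_piecewise s f -> diff_smooth P -> contact s f P ->
  exists (B : list R) (D : R), 0 <= D /\
    forall (N : nat) (j : Z), (s + 2 <= N)%nat -> (- Z.of_nat N <= j < Z.of_nat N)%Z ->
      Rabs (zdiff (s + 2) (periodized f P N) j) <= D / INR N ^ (s + 1) /\
      ((forall b, In b B -> ~ (IZR j / INR N <= b <= IZR (j + Z.of_nat (s + 2)) / INR N)) ->
       Rabs (zdiff (s + 2) (periodized f P N) j) <= D / INR N ^ (s + 2)).
Proof.
  intros [B [C [HC Hf]]] HP Hc. pose proof Hc as [E [HE HfP]].
  destruct (HP (s + 2)%nat 2) as [C' [HC' HP']].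
  set (m := (s + 2)%nat) in *.
  set (D := 2 ^ m * (E * INR m ^ (s + 1))).
  pose proof (pos_INR m) as Hm.
  assert (HD : 0 <= D).
  { unfold D. apply Rmult_le_pos; [apply pow_le; lra|].
    apply Rmult_le_pos; auto. apply pow_le; auto. }
  exists (0 :: 1 :: B), (C + C' + D). split; [lra|].
  intros N j HN Hj.
  assert (HN1 : (1 <= N)%nat) by (unfold m in HN; lia).
  pose proof (le_INR 1 N HN1) as HN'. simpl (INR 1) in HN'.
  assert (Hh : 0 <= / INR N <= 1).
  { split; [left; apply Rinv_0_lt_compat; lra|].
    rewrite <- Rinv_1. apply Rinv_le_contravar; lra. }
  assert (HpN : 0 < INR N ^ (s + 1)) by (apply pow_lt; lra).
  assert (HpNm : INR N ^ m = INR N * INR N ^ (s + 1))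
    by (unfold m; replace (s + 2)%nat with (S (s + 1)) by lia; reflexivity).
  assert (HpN2 : 0 < INR N ^ m) by (apply pow_lt; lra).
  assert (Hmono : forall c, 0 <= c -> c / INR N ^ m <= c / INR N ^ (s + 1)).
  { intros c Hc0. apply Rmult_le_compat_l; auto. apply Rinv_le_contravar; auto. nra. }
  assert (Hsum : forall a b c k, 0 <= a -> 0 <= b -> 0 <= c ->
     a / INR N ^ k + 0 <= (a + b + c) / INR N ^ k).
  { intros a b c k Ha Hb Hc0. rewrite Rplus_0_r. apply Rmult_le_compat_r; [|lra].
    left. apply Rinv_0_lt_compat, pow_lt. lra. }
  assert (HPx : forall x, Rabs x <= 2 -> Rabs (fdiff m (/ INR N) P x) <= C' / INR N ^ m).
  { intros x Hx. specialize (HP' x (/ INR N) Hx Hh). rewrite pow_inv in HP'. exact HP'. }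
  assert (HjN : Rabs (IZR j / INR N) <= 1).
  { assert (- INR N <= IZR j <= INR N).
    { rewrite INR_IZR_INZ, <- opp_IZR. split; apply IZR_le; lia. }
    apply Rabs_le. split; [apply Rle_div_r|apply Rle_div_l]; lra. }
  (* the contact error at distance [k / N <= m / N] from the junction *)
  assert (HEk : forall k, (0 <= k <= Z.of_nat m)%Z ->
     0 <= IZR k / INR N <= 1 /\
     E * (IZR k / INR N) ^ (s + 1) <= E * INR m ^ (s + 1) / INR N ^ (s + 1)).
  { intros k Hk. assert (Hk0 : 0 <= IZR k) by (apply IZR_le; lia).
    assert (HkN : IZR k <= INR N) by (rewrite INR_IZR_INZ; apply IZR_le; lia).
    assert (Hkm : IZR k <= INR m) by (rewrite INR_IZR_INZ; apply IZR_le; lia).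
    split; [split; [apply Rdiv_le_0_compat; lra|apply Rle_div_l; lra]|].
    unfold Rdiv. rewrite Rmult_assoc. apply Rmult_le_compat_l; auto.
    rewrite Rpow_mult_distr, pow_inv. apply Rmult_le_compat_r.
    - left. apply Rinv_0_lt_compat; auto.
    - apply pow_incr. lra. }
  assert (HE0 : 0 <= E * INR m ^ (s + 1) / INR N ^ (s + 1)).
  { apply Rdiv_le_0_compat; auto. apply Rmult_le_pos; auto. apply pow_le; auto. }
  destruct (Z_le_gt_dec (j + Z.of_nat m) 0) as [H1|H1].
  (* inside [[-1, 0]] *)
  { assert (HB : Rabs (zdiff m (periodized f P N) j) <= (C + C' + D) / INR N ^ m).
    { eapply Rle_trans; [apply (zdiff_near m N _ P j 0); auto|].
      - intros i Hi. rewrite (periodized_left f P s N) by (auto; lia).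
        unfold Rminus. rewrite Rplus_opp_r, Rabs_R0. lra.
      - rewrite Rmult_0_r. specialize (HPx (IZR j / INR N) ltac:(lra)).
        specialize (Hsum C' C D m HC' HC HD).
        replace (C + C' + D) with (C' + C + D) by ring. lra. }
    split; auto. eapply Rle_trans; [exact HB|]. apply Hmono. lra. }
  destruct (Z_lt_ge_dec j 0) as [H2|H2].
  (* across [0] *)
  { split.
    - eapply Rle_trans; [apply (zdiff_near m N _ P j (E * INR m ^ (s + 1) / INR N ^ (s + 1))); auto|].
      + intros i Hi. destruct (Z_le_gt_dec (j + i) 0) as [Hji|Hji].
        * rewrite (periodized_left f P s N) by (auto; lia).
          unfold Rminus. rewrite Rplus_opp_r, Rabs_R0. auto.
        * rewrite (periodized_middle f P s N) by (auto; lia).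
          destruct (HEk (j + i)%Z ltac:(lia)) as [Hk1 Hk2].
          destruct (HfP _ Hk1) as [Hf1 _]. lra.
      + specialize (HPx (IZR j / INR N) ltac:(lra)). specialize (Hmono C' HC').
        replace (2 ^ m * (E * INR m ^ (s + 1) / INR N ^ (s + 1))) with (D / INR N ^ (s + 1))
          by (unfold D, Rdiv; ring).
        specialize (Hsum (C' + D) C 0 (s + 1)%nat ltac:(lra) HC ltac:(lra)).
        replace (C + C' + D) with (C' + D + C + 0) by ring.
        unfold Rdiv in *. lra.
    - intros Hno. exfalso. apply (Hno 0); [left; reflexivity|]. split.
      + apply Rle_div_l; [lra|]. rewrite Rmult_0_l. apply IZR_le. lia.
      + apply Rdiv_le_0_compat; [|lra]. apply IZR_le. lia. }
  destruct (Z_le_gt_dec (j + Z.of_nat m) (Z.of_nat N)) as [H3|H3].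
  (* inside [[0, 1]] *)
  { assert (HZ : Rabs (zdiff m (periodized f P N) j)
                 <= Rabs (fdiff m (/ INR N) f (IZR j / INR N)) + 2 ^ m * 0).
    { apply zdiff_near; auto. intros i Hi. rewrite (periodized_middle f P s N) by (auto; lia).
      unfold Rminus. rewrite Rplus_opp_r, Rabs_R0. lra. }
    destruct (Hf N j HN1 ltac:(lia) ltac:(lia)) as [Hf1 Hf2].
    rewrite Rmult_0_r in HZ. split.
    - specialize (Hsum C C' D (s + 1)%nat HC HC' HD). lra.
    - intros Hno. specialize (Hsum C C' D m HC HC' HD).
      assert (Rabs (fdiff m (/ INR N) f (IZR j / INR N)) <= C / INR N ^ m); [|lra].
      apply Hf2. intros b Hb. apply Hno. right. right. auto. }
  (* across [1] *)
  split.
  - eapply Rle_trans; [apply (zdiff_near m N _ (fun y => P (y + -2)) j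
                         (E * INR m ^ (s + 1) / INR N ^ (s + 1))); auto|].
    + intros i Hi. destruct (Z_le_gt_dec (Z.of_nat N) (j + i)) as [Hji|Hji].
      * rewrite (periodized_right f P s N) by (auto; lia).
        unfold Rminus. rewrite Rplus_opp_r, Rabs_R0. auto.
      * rewrite (periodized_middle f P s N) by (auto; lia).
        destruct (HEk (Z.of_nat N - (j + i))%Z ltac:(lia)) as [Hk1 Hk2].
        destruct (HfP _ Hk1) as [_ Hf1].
        replace (1 - IZR (Z.of_nat N - (j + i)) / INR N) with (IZR (j + i) / INR N) in Hf1
          by (rewrite minus_IZR, <- INR_IZR_INZ; field; lra).
        replace (-1 - IZR (Z.of_nat N - (j + i)) / INR N) with (IZR (j + i) / INR N + -2) in Hf1
          by (rewrite minus_IZR, <- INR_IZR_INZ; field; lra).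
        lra.
    + rewrite fdiff_shift.
      assert (Hx : Rabs (IZR j / INR N + -2) <= 2).
      { assert (0 <= IZR j / INR N) by (apply Rdiv_le_0_compat; [apply IZR_le; lia|lra]).
        rewrite Rabs_pos_eq in HjN by auto. apply Rabs_le. lra. }
      specialize (HPx _ Hx). specialize (Hmono C' HC').
      replace (2 ^ m * (E * INR m ^ (s + 1) / INR N ^ (s + 1))) with (D / INR N ^ (s + 1))
        by (unfold D, Rdiv; ring).
      specialize (Hsum (C' + D) C 0 (s + 1)%nat ltac:(lra) HC ltac:(lra)).
      replace (C + C' + D) with (C' + D + C + 0) by ring.
      unfold Rdiv in *. lra.
  - intros Hno. exfalso. apply (Hno 1); [right; left; reflexivity|]. split.
    + apply Rle_div_l; [lra|]. rewrite Rmult_1_l, INR_IZR_INZ. apply IZR_le. lia.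
    + apply Rle_div_r; [lra|]. rewrite Rmult_1_l, INR_IZR_INZ. apply IZR_le. lia.
Qed.

(** The [2 N] ordinary stencils contribute [O(N^-(s+2))] each, the boundedly many
    exceptional ones [O(N^-(s+1))] each. *)
Lemma periodized_variation (s : nat) (f P : R -> R) :
  diff_piecewise s f -> diff_smooth P -> contact s f P ->
  exists K, 0 <= K /\ forall N : nat, (s + 2 <= N)%nat ->
    rsum (fun i => Rabs (zdiff (s + 2) (periodized f P N) (Z.of_nat i - Z.of_nat N)%Z)) (2 * N)
      <= K / INR N ^ (s + 1).
Proof.
  intros Hf HP Hc.
  destruct (periodized_zdiff s f P Hf HP Hc) as [B [D [HD H]]].
  set (m := (s + 2)%nat) in *.
  pose proof (pos_INR m) as Hm. pose proof (pos_INR (length B)) as HB.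
  exists (2 * D + D * (INR (length B) * (INR m + 1))).
  split; [apply Rplus_le_le_0_compat; [lra|]; repeat apply Rmult_le_pos; lra|]. intros N HN.
  assert (HN1 : (1 <= N)%nat) by (unfold m in HN; lia).
  pose proof (lt_0_INR N ltac:(lia)) as HN'.
  assert (HpN : 0 < INR N ^ (s + 1)) by (apply pow_lt; lra).
  assert (HpNm : INR N ^ m = INR N * INR N ^ (s + 1))
    by (unfold m; replace (s + 2)%nat with (S (s + 1)) by lia; reflexivity).
  eapply Rle_trans.
  - apply (rsum_exceptional (map (fun b => INR N * b + INR N) B) (INR m)
             (D / INR N ^ m) (D / INR N ^ (s + 1))); auto.
    + apply Rdiv_le_0_compat; auto. apply pow_lt; auto.
    + apply Rdiv_le_0_compat; auto.
    + intros i Hi. apply H; lia.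
    + intros i Hi Hno. apply H; [lia|lia|]. intros b Hb [Hb1 Hb2].
      apply (Hno (INR N * b + INR N)).
      * apply in_map_iff. exists b. auto.
      * rewrite plus_IZR, minus_IZR, <- !INR_IZR_INZ in Hb2.
        rewrite minus_IZR, <- !INR_IZR_INZ in Hb1.
        apply Rle_div_l in Hb1; auto. apply Rle_div_r in Hb2; auto. lra.
  - rewrite length_map, HpNm, mult_INR. simpl (INR 2). right. field.
    split; lra.
Qed.

(** Fine grids refining the grid of step [1 / n], as fine as desired; the last
    point [1] is avoided because indices range over [0 <= j < n M]. *)
Lemma grid_dense (n m : nat) (x d : R) : (1 <= n)%nat -> 0 <= x <= 1 -> 0 < d ->
  exists (M : nat) (j : Z), (1 <= M)%nat /\ (m <= n * M)%nat /\
    (0 <= j < Z.of_nat (n * M))%Z /\ Rabs (IZR j / INR (n * M) - x) < d.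
Proof.
  intros Hn Hx Hd.
  destruct (archimed_cor1 d Hd) as [M0 [HM0 HM0']].
  set (M := (M0 + m)%nat). exists M.
  assert (HM : (M <= n * M)%nat) by nia.
  set (N := (n * M)%nat) in *.
  assert (HN : (1 <= N)%nat) by (unfold M in *; lia).
  pose proof (lt_0_INR N ltac:(lia)) as HN'.
  assert (HNd : / INR N < d).
  { eapply Rle_lt_trans; [|exact HM0]. apply Rinv_le_contravar.
    - apply lt_0_INR. auto.
    - apply le_INR. unfold M in *. lia. }
  set (z := (up (x * INR N) - 1)%Z).
  destruct (archimed (x * INR N)) as [Ha1 Ha2].
  assert (Hz1 : IZR z <= x * INR N) by (unfold z; rewrite minus_IZR; lra).
  assert (Hz2 : x * INR N < IZR z + 1) by (unfold z; rewrite minus_IZR; lra).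
  assert (Hz0 : (0 <= z)%Z).
  { apply Z.lt_succ_r, lt_IZR. unfold Z.succ. rewrite plus_IZR.
    assert (0 <= x * INR N) by nra. lra. }
  assert (HzN : (z <= Z.of_nat N)%Z).
  { apply le_IZR. rewrite <- INR_IZR_INZ. nra. }
  assert (Hdist : forall j, x * INR N - 1 <= IZR j <= x * INR N ->
    Rabs (IZR j / INR N - x) < d).
  { intros j Hj. replace (IZR j / INR N - x) with ((IZR j - x * INR N) * / INR N)
      by (field; lra).
    assert (0 < / INR N) by (apply Rinv_0_lt_compat; auto).
    rewrite Rabs_mult, (Rabs_pos_eq (/ _)) by lra.
    assert (Rabs (IZR j - x * INR N) <= 1) by (apply Rabs_le; lra). nra. }
  destruct (Z.eq_dec z (Z.of_nat N)) as [E|E].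
  - exists (z - 1)%Z. split; [unfold M in *; lia|]. split; [unfold M in *; lia|].
    split; [lia|]. apply Hdist. rewrite minus_IZR.
    assert (IZR z = INR N) by (rewrite E; symmetry; apply INR_IZR_INZ). nra.
  - exists z. split; [unfold M in *; lia|]. split; [unfold M in *; lia|].
    split; [lia|]. apply Hdist. lra.
Qed.

(** The bound on the fine grids does not depend on their step, and both sides are
    continuous in [x]. *)
Lemma continuation_error (s : nat) (f P : R -> R) :
  diff_piecewise s f -> diff_smooth P -> contact s f P ->
  continuous_on (Icc 0 1) f ->
  exists K, 0 <= K /\ forall (n : nat) (x : R), (1 <= n)%nat -> 0 <= x <= 1 ->
    Cmod (trig n (fun j => RtoC (glue f P n j)) x - RtoC (f x)) <= K / INR n ^ (s + 1).
Proof.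
  intros Hf HP Hc Hcont.
  destruct (periodized_variation s f P Hf HP Hc) as [K [HK HV]].
  exists (8 * K). split; [lra|]. intros n x Hn Hx.
  apply le_epsilon. intros eps Heps.
  set (T := trig n (fun j => RtoC (glue f P n j))).
  destruct (trig_lipschitz n (fun j => RtoC (glue f P n j))) as [L [HL HT]]. fold T in HT.
  destruct (Hcont x Hx (ball (f x) (mkposreal (eps / 2) ltac:(lra)))) as [d Hd].
  { apply locally_ball. }
  assert (HL1 : 0 < eps / 2 / (L + 1)) by (apply Rdiv_lt_0_compat; lra).
  destruct (grid_dense n (s + 2) x (Rmin d (eps / 2 / (L + 1))) Hn Hx) as [M [j [HM [HmM [Hj Hjx]]]]].
  { apply Rmin_glb_lt; auto. apply cond_pos. }
  set (N := (n * M)%nat) in *.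
  assert (HN : (1 <= N)%nat) by lia.
  pose proof (lt_0_INR N ltac:(lia)) as HN'.
  pose proof (lt_0_INR n ltac:(lia)) as Hn'.
  pose proof (lt_0_INR M ltac:(lia)) as HM'.
  set (y := IZR j / INR N) in *.
  assert (Hy : 0 <= y <= 1).
  { unfold y. split.
    - apply Rdiv_le_0_compat; auto. apply IZR_le. lia.
    - apply Rle_div_l; auto. rewrite Rmult_1_l, INR_IZR_INZ. apply IZR_le. lia. }
  assert (H1 : Cmod (T y - RtoC (f y)) <= 8 * K / INR n ^ (s + 1)).
  { pose proof (trig_error_fine_grid n M s (periodized f P N) K j Hn HM
      (periodized_periodic f P N HN) HK (HV N HmM) ltac:(fold N; lia)) as H.
    rewrite (periodized_middle f P s N) in H by (auto; lia).
    fold N y in H. unfold T. rewrite (trig_ext n _ (fun j => RtoC (periodized f P N (j * Z.of_nat M)))); auto.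
    intros k Hk. f_equal. rewrite periodized_base by (unfold N; nia).
    unfold glue.
    replace (IZR (k * Z.of_nat M) / INR N) with (IZR k / INR n)
      by (unfold N; rewrite mult_IZR, mult_INR, <- INR_IZR_INZ; field; lra).
    destruct (Z.leb_spec 0 k); destruct (Z.leb_spec 0 (k * Z.of_nat M)); auto; nia. }
  assert (H2 : Cmod (T x - T y) <= eps / 2).
  { eapply Rle_trans; [apply HT|]. rewrite Rabs_minus_sym.
    assert (Hjx' : Rabs (y - x) <= eps / 2 / (L + 1)).
    { left. eapply Rlt_le_trans; [exact Hjx|apply Rmin_r]. }
    apply Rle_trans with ((L + 1) * (eps / 2 / (L + 1))).
    - apply Rmult_le_compat; auto using Rabs_pos; lra.
    - right. field. lra. }
  assert (H3 : Rabs (f y - f x) <= eps / 2).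
  { left. apply (Hd y); auto.
    unfold ball; simpl; unfold AbsRing_ball; simpl.
    eapply Rlt_le_trans; [exact Hjx|apply Rmin_l]. }
  replace (T x - RtoC (f x))%C
    with ((T y - RtoC (f y)) + ((T x - T y) + RtoC (f y - f x)))%C
    by (rewrite RtoC_minus; ring).
  eapply Rle_trans; [apply Cmod_triangle|].
  apply Rplus_le_compat; auto.
  eapply Rle_trans; [apply Cmod_triangle|]. rewrite Cmod_R. lra.
Qed.

(** * Mean value estimates *)

Lemma mean_value_bound (F dF : R -> R) (a b M : R) : a <= b ->
  (forall x, a < x < b -> is_derive F x (dF x)) ->
  (forall x, a <= x <= b -> continuity_pt F x) ->
  (forall x, a <= x <= b -> Rabs (dF x) <= M) ->
  Rabs (F b - F a) <= M * (b - a).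
Proof.
  intros Hab Hd Hc HM.
  destruct (MVT_gen F a b dF) as [c [Hc1 ->]]; rewrite ?Rmin_left, ?Rmax_right in * by lra; auto.
  rewrite Rabs_mult, (Rabs_pos_eq (b - a)) by lra.
  apply Rmult_le_compat_r; [lra|]. auto.
Qed.

(** [d 0, ..., d k] are successive derivatives on [[a, b]]. *)
Definition tower (k : nat) (d : nat -> R -> R) (a b : R) : Prop :=
  (forall i y, (i < k)%nat -> a <= y <= b -> continuity_pt (d i) y) /\
  (forall i y, (i < k)%nat -> a < y < b -> is_derive (d i) y (d (S i) y)).

Definition delta (h : R) (g : R -> R) (y : R) : R := g (y + h) - g y.

Lemma is_derive_shift (F : R -> R) (y a l : R) :
  is_derive F (y + a) l -> is_derive (fun z => F (z + a)) y l.
Proof.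
  intros H. replace l with (scal 1 l) by apply (scal_one (V := R_ModuleSpace) l).
  apply (is_derive_comp F (fun z => z + a)); auto.
  auto_derive; auto.
Qed.

Lemma is_derive_delta (F : R -> R) (y h l l' : R) :
  is_derive F (y + h) l -> is_derive F y l' -> is_derive (delta h F) y (l - l').
Proof.
  intros H H'. apply (is_derive_minus (fun z => F (z + h)) F); auto using is_derive_shift.
Qed.

Lemma continuity_delta (F : R -> R) (y h : R) :
  continuity_pt F (y + h) -> continuity_pt F y -> continuity_pt (delta h F) y.
Proof.
  intros H H'. apply (continuity_pt_minus (fun z => F (z + h)) F); auto.
  apply (continuity_pt_comp (fun z => z + h) F); auto.
  apply continuity_pt_plus; [apply continuity_pt_id|].
  apply continuity_pt_const. intros ? ?. reflexivity.
Qed.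

Lemma tower_delta (k : nat) (d : nat -> R -> R) (a b h : R) : 0 <= h ->
  tower k d a (b + h) -> tower k (fun i => delta h (d i)) a b.
Proof.
  intros Hh [Hc Hd]. split; intros i y Hi Hy.
  - apply continuity_delta; apply Hc; auto; lra.
  - apply is_derive_delta; apply Hd; auto; lra.
Qed.

Lemma tower_restrict (k k' : nat) (d : nat -> R -> R) (a b a' b' : R) :
  (k' <= k)%nat -> a <= a' -> b' <= b -> tower k d a b -> tower k' d a' b'.
Proof.
  intros Hk Ha Hb [Hc Hd]. split; intros i y Hi Hy.
  - apply Hc; [lia|lra].
  - apply Hd; [lia|lra].
Qed.

(** Each difference is exchanged for a derivative and a factor [h] by the mean
    value theorem, applied to the whole tower at once. *)
Lemma fdiff_bound (k : nat) (d : nat -> R -> R) (x h E : R) : 0 <= h ->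
  tower k d x (x + INR k * h) ->
  (forall y, x <= y <= x + INR k * h -> Rabs (d k y) <= E) ->
  Rabs (fdiff k h (d 0%nat) x) <= h ^ k * E.
Proof.
  intros Hh. revert d E. induction k as [|k IH]; intros d E Ht HE.
  - simpl in *. rewrite Rmult_1_l. apply HE. lra.
  - rewrite S_INR in *. pose proof (pos_INR k) as Hk.
    replace (x + (INR k + 1) * h) with (x + INR k * h + h) in * by ring.
    change (fdiff (S k) h (d 0%nat) x) with (fdiff k h (delta h (d 0%nat)) x).
    replace (h ^ S k * E) with (h ^ k * (E * h)) by (simpl; ring).
    apply (IH (fun i => delta h (d i))).
    + apply tower_delta; auto. revert Ht. apply tower_restrict; [lia|lra|lra].
    + intros y Hy. unfold delta. replace (E * h) with (E * (y + h - y)) by ring.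
      destruct Ht as [Hc Hd].
      apply (mean_value_bound _ (d (S k))); [lra| | |].
      * intros z Hz. apply Hd; [lia|lra].
      * intros z Hz. apply Hc; [lia|lra].
      * intros z Hz. apply HE. lra.
Qed.

Lemma fdiff_ext_stencil (m : nat) (h : R) (g g' : R -> R) (x : R) : 0 <= h ->
  (forall y, x <= y <= x + INR m * h -> g y = g' y) -> fdiff m h g x = fdiff m h g' x.
Proof.
  intros Hh. revert g g'. induction m as [|m IH]; intros g g' H; simpl fdiff.
  - apply H. simpl. lra.
  - rewrite S_INR in H. pose proof (pos_INR m).
    apply IH. intros y Hy. rewrite !H by nra. reflexivity.
Qed.

Lemma taylor_sum_derive (c : nat -> R) (r : nat) (y : R) :
  is_derive (fun y => sum_n (fun i => c i / INR (fact i) * y ^ i) (S r)) y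
            (sum_n (fun i => c (S i) / INR (fact i) * y ^ i) r).
Proof.
  apply is_derive_ext with
    (fun y => c 0%nat + sum_n (fun i => c (S i) / INR (fact (S i)) * y ^ S i) r).
  { intros z. unfold sum_n. rewrite (sum_Sn_m _ 0 (S r)) by lia.
    rewrite <- (sum_n_m_S (fun i => c i / INR (fact i) * z ^ i) 0 r). simpl (fact 0). simpl (z ^ 0). unfold plus; simpl.
    f_equal. field. }
  replace (sum_n (fun i => c (S i) / INR (fact i) * y ^ i) r)
    with (0 + sum_n (fun i => c (S i) / INR (fact i) * y ^ i) r) by ring.
  apply (is_derive_plus (fun _ => c 0%nat)); [auto_derive; auto|].
  apply (is_derive_sum_n (fun i z => c (S i) / INR (fact (S i)) * z ^ S i)).
  intros i _. rewrite fact_simpl, mult_INR, S_INR.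
  pose proof (INR_fact_neq_0 i) as Hf. pose proof (pos_INR i).
  generalize dependent (INR (fact i)). intros F Hf.
  auto_derive; auto.
  change (match i with 0%nat => 1 | S _ => INR i + 1 end) with (INR (S i)).
  rewrite S_INR. field. split; lra.
Qed.

(** Taylor's formula when only [d r] is controlled, by a Lipschitz condition:
    the remainder of [d 0] has the remainder of [d 1] as its derivative. *)
Lemma taylor_bound (r : nat) (d : nat -> R -> R) (L : R) : tower r d 0 1 ->
  (forall y, 0 <= y <= 1 -> Rabs (d r y - d r 0) <= L * y) ->
  forall y, 0 <= y <= 1 ->
  Rabs (d 0%nat y - sum_n (fun i => d i 0 / INR (fact i) * y ^ i) r) <= L * y ^ (r + 1).
Proof.
  revert d. induction r as [|r IH]; intros d Ht HL y Hy.
  - rewrite sum_O. simpl. rewrite !Rmult_1_r, Rdiv_1_r. auto.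
  - assert (HL0 : 0 <= L).
    { specialize (HL 1 ltac:(lra)). pose proof (Rabs_pos (d (S r) 1 - d (S r) 0)). lra. }
    destruct Ht as [Hc Hd].
    assert (IH' : forall z, 0 <= z <= 1 ->
      Rabs (d 1%nat z - sum_n (fun i => d (S i) 0 / INR (fact i) * z ^ i) r) <= L * z ^ (r + 1)).
    { apply (IH (fun i => d (S i))); auto.
      split; intros i z Hi Hz; [apply Hc|apply Hd]; auto; lia. }
    set (E := fun z => d 0%nat z - sum_n (fun i => d i 0 / INR (fact i) * z ^ i) (S r)).
    assert (E0 : E 0 = 0).
    { unfold E, sum_n. rewrite (sum_Sn_m _ 0 (S r)) by lia.
      rewrite (sum_n_m_ext_loc _ (fun _ => zero) 1 (S r)).
      - rewrite sum_n_m_const_zero. unfold plus, zero; simpl. field.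
      - intros i Hi. rewrite pow_i, Rmult_0_r by lia. reflexivity. }
    pose proof (mean_value_bound E
      (fun z => d 1%nat z - sum_n (fun i => d (S i) 0 / INR (fact i) * z ^ i) r)
      0 y (L * y ^ (r + 1))) as H.
    rewrite E0, !Rminus_0_r in H.
    replace (L * y ^ (S r + 1)) with (L * y ^ (r + 1) * y) by (simpl; ring).
    apply H; [lra| | |].
    + intros z Hz. apply (is_derive_minus (d 0%nat)).
      * apply Hd; [lia|lra].
      * apply (taylor_sum_derive (fun i => d i 0)).
    + intros z Hz. apply (continuity_pt_minus (d 0%nat)).
      * apply Hc; [lia|lra].
      * apply continuity_pt_filterlim. apply (ex_derive_continuous (V := R_NormedModule)).
        eexists. apply (taylor_sum_derive (fun i => d i 0)).
    + intros z Hz. eapply Rle_trans; [apply IH'; lra|].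
      apply Rmult_le_compat_l; auto. apply pow_incr. lra.
Qed.

(** * Lipschitz estimates with finitely many exceptional points *)

(** On each of the finitely many components of the complement of [B] the function
    is Lipschitz; the induction splits the interval at a point of [B]. *)
Lemma bounded_off_list (B : list R) (F : R -> R) (L a b : R) :
  (forall x y, a < x -> x <= y -> y < b -> (forall t, In t B -> ~ (x <= t <= y)) ->
     Rabs (F y - F x) <= L * (y - x)) ->
  exists M, forall x, a < x < b -> ~ In x B -> Rabs (F x) <= M.
Proof.
  revert a b. induction B as [|t B IH]; intros a b H.
  - set (c := (a + b) / 2). exists (Rabs (F c) + Rabs L * (b - a)). intros x Hx _.
    assert (Hxc : Rabs (F x - F c) <= Rabs L * (b - a)).
    { pose proof (Rle_abs L) as HL. pose proof (Rabs_pos L).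
      destruct (Rle_lt_dec c x) as [Hcx|Hcx].
      - eapply Rle_trans; [apply H; unfold c in *; simpl; auto; lra|]. unfold c in *. nra.
      - rewrite Rabs_minus_sym.
        eapply Rle_trans; [apply H; unfold c in *; simpl; auto; lra|]. unfold c in *. nra. }
    pose proof (Rabs_triang (F x - F c) (F c)) as T.
    replace (F x - F c + F c) with (F x) in T by ring. lra.
  - destruct (Rlt_le_dec a t) as [Hat|Hat]; [destruct (Rlt_le_dec t b) as [Htb|Htb]|].
    + destruct (IH a t) as [M1 H1].
      { intros x y Hx Hxy Hy Hno. apply H; auto; [lra|].
        intros t' [<-|Ht']; [lra|auto]. }
      destruct (IH t b) as [M2 H2].
      { intros x y Hx Hxy Hy Hno. apply H; auto; [lra|].
        intros t' [<-|Ht']; [lra|auto]. }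
      exists (Rmax M1 M2). intros x Hx Hno.
      destruct (Rtotal_order x t) as [Hxt|[Hxt|Hxt]].
      * eapply Rle_trans; [apply H1; [lra|]|apply Rmax_l]. intros Hin. apply Hno. right. auto.
      * exfalso. apply Hno. left. auto.
      * eapply Rle_trans; [apply H2; [lra|]|apply Rmax_r]. intros Hin. apply Hno. right. auto.
    + destruct (IH a b) as [M HM].
      { intros x y Hx Hxy Hy Hno. apply H; auto. intros t' [<-|Ht']; [lra|auto]. }
      exists M. intros x Hx Hno. apply HM; auto. intros Hin. apply Hno. right. auto.
    + destruct (IH a b) as [M HM].
      { intros x y Hx Hxy Hy Hno. apply H; auto. intros t' [<-|Ht']; [lra|auto]. }
      exists M. intros x Hx Hno. apply HM; auto. intros Hin. apply Hno. right. auto.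
Qed.

(** Continuity joins the Lipschitz bounds of adjacent components. *)
Lemma lipschitz_off_list (B : list R) (F : R -> R) (L a b : R) : 0 <= L -> a <= b ->
  (forall x, continuity_pt F x) ->
  (forall x y, a < x -> x <= y -> y < b -> (forall t, In t B -> ~ (x <= t <= y)) ->
     Rabs (F y - F x) <= L * (y - x)) ->
  Rabs (F b - F a) <= L * (b - a).
Proof.
  intros HL. revert a b. induction B as [|t B IH]; intros a b Hab Hc H.
  - destruct Hab as [Hab| ->].
    2:{ unfold Rminus. rewrite !Rplus_opp_r, Rabs_R0. lra. }
    apply le_epsilon. intros eps Heps.
    assert (Hcont : forall x, exists d, 0 < d /\ forall y, Rabs (y - x) < d -> Rabs (F y - F x) < eps / 2).
    { intros x. destruct (Hc x (eps / 2) ltac:(lra)) as [d [Hd H']].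
      exists d. split; auto. intros y Hy.
      destruct (Req_dec x y) as [->|Hne].
      - unfold Rminus. rewrite Rplus_opp_r, Rabs_R0. lra.
      - apply (H' y). split; [split; [exact I|auto]|exact Hy]. }
    destruct (Hcont a) as [da [Hda Ha]]. destruct (Hcont b) as [db [Hdb Hb]].
    set (x := a + Rmin (da / 2) ((b - a) / 3)).
    set (y := b - Rmin (db / 2) ((b - a) / 3)).
    pose proof (Rmin_l (da / 2) ((b - a) / 3)). pose proof (Rmin_r (da / 2) ((b - a) / 3)).
    pose proof (Rmin_l (db / 2) ((b - a) / 3)). pose proof (Rmin_r (db / 2) ((b - a) / 3)).
    assert (0 < Rmin (da / 2) ((b - a) / 3)) by (apply Rmin_glb_lt; lra).
    assert (0 < Rmin (db / 2) ((b - a) / 3)) by (apply Rmin_glb_lt; lra).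
    specialize (Ha x ltac:(unfold x; apply Rabs_lt_between; lra)).
    specialize (Hb y ltac:(unfold y; apply Rabs_lt_between; lra)).
    assert (Hxy : Rabs (F y - F x) <= L * (y - x))
      by (apply H; unfold x, y; simpl; auto; lra).
    assert (L * (y - x) <= L * (b - a)) by (apply Rmult_le_compat_l; unfold x, y; lra).
    rewrite Rabs_minus_sym in Hb.
    replace (F b - F a) with ((F b - F y) + ((F y - F x) + (F x - F a))) by ring.
    eapply Rle_trans; [apply Rabs_triang|].
    pose proof (Rabs_triang (F y - F x) (F x - F a)). lra.
  - destruct (Rlt_le_dec a t) as [Hat|Hat]; [destruct (Rlt_le_dec t b) as [Htb|Htb]|].
    + assert (H1 : Rabs (F t - F a) <= L * (t - a)).
      { apply IH; auto; [lra|]. intros x y Hx Hxy Hy Hno. apply H; auto; [lra|].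
        intros t' [<-|Ht']; [lra|auto]. }
      assert (H2 : Rabs (F b - F t) <= L * (b - t)).
      { apply IH; auto; [lra|]. intros x y Hx Hxy Hy Hno. apply H; auto; [lra|].
        intros t' [<-|Ht']; [lra|auto]. }
      replace (F b - F a) with ((F b - F t) + (F t - F a)) by ring.
      eapply Rle_trans; [apply Rabs_triang|]. lra.
    + apply IH; auto. intros x y Hx Hxy Hy Hno. apply H; auto. intros t' [<-|Ht']; [lra|auto].
    + apply IH; auto. intros x y Hx Hxy Hy Hno. apply H; auto. intros t' [<-|Ht']; [lra|auto].
Qed.

(** * Derivatives within a compact interval *)

Lemma is_derive_on_eps (I : R -> Prop) (f : R -> R) (x l : R) : is_derive_on I f x l ->
  forall eps, 0 < eps -> exists d, 0 < d /\
    forall y, I y -> Rabs (y - x) < d -> Rabs (f y - f x - (y - x) * l) <= eps * Rabs (y - x).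
Proof.
  intros [_ H] eps Heps.
  assert (Hx : is_filter_lim (within I (locally x)) x) by (intros P HP; apply filter_le_within; auto).
  destruct (H x Hx (mkposreal eps Heps)) as [d Hd].
  exists d. split; [apply cond_pos|]. intros y Hy Hyx. apply (Hd y Hyx Hy).
Qed.

(** Every point of a nondegenerate interval, endpoints included, is a limit of
    other points of it. *)
Lemma is_derive_on_unique (a b : R) (f : R -> R) (x l l' : R) : a < b -> Icc a b x ->
  is_derive_on (Icc a b) f x l -> is_derive_on (Icc a b) f x l' -> l = l'.
Proof.
  intros Hab Hx H H'. apply Rminus_diag_uniq, Rabs_eq_0, Rle_antisym; [|apply Rabs_pos].
  apply le_epsilon. intros eps Heps. rewrite Rplus_0_l.
  destruct (is_derive_on_eps _ _ _ _ H (eps / 2) ltac:(lra)) as [d [Hd H1]].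
  destruct (is_derive_on_eps _ _ _ _ H' (eps / 2) ltac:(lra)) as [d' [Hd' H2]].
  assert (Hy : exists y, Icc a b y /\ 0 < Rabs (y - x) < Rmin d d').
  { assert (0 < Rmin d d') by (apply Rmin_glb_lt; auto). unfold Icc in *.
    destruct (Rle_lt_dec ((a + b) / 2) x).
    - pose proof (Rmin_l (Rmin d d' / 2) ((b - a) / 2)).
      pose proof (Rmin_r (Rmin d d' / 2) ((b - a) / 2)).
      assert (0 < Rmin (Rmin d d' / 2) ((b - a) / 2)) by (apply Rmin_glb_lt; lra).
      exists (x - Rmin (Rmin d d' / 2) ((b - a) / 2)). split; [lra|].
      rewrite Rabs_left; lra.
    - pose proof (Rmin_l (Rmin d d' / 2) ((b - a) / 2)).
      pose proof (Rmin_r (Rmin d d' / 2) ((b - a) / 2)).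
      assert (0 < Rmin (Rmin d d' / 2) ((b - a) / 2)) by (apply Rmin_glb_lt; lra).
      exists (x + Rmin (Rmin d d' / 2) ((b - a) / 2)). split; [lra|].
      rewrite Rabs_right; lra. }
  destruct Hy as [y [Hy [Hy0 Hyd]]].
  pose proof (Rmin_l d d'). pose proof (Rmin_r d d').
  specialize (H1 y Hy ltac:(lra)). specialize (H2 y Hy ltac:(lra)).
  apply (Rmult_le_reg_l (Rabs (y - x))); auto.
  rewrite <- Rabs_mult.
  replace ((y - x) * (l - l')) with ((f y - f x - (y - x) * l') - (f y - f x - (y - x) * l)) by ring.
  eapply Rle_trans; [apply Rabs_triang|]. rewrite Rabs_Ropp. lra.
Qed.

Lemma Derive_on_correct (a b : R) (f : R -> R) (x : R) : a < b -> Icc a b x ->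
  ex_derive_on (Icc a b) f x -> is_derive_on (Icc a b) f x (Derive_on (Icc a b) f x).
Proof.
  intros Hab Hx [l Hl]. unfold Derive_on.
  apply (iota_correct (fun l => is_derive_on (Icc a b) f x l)).
  exists l. split; auto. intros l' Hl'. eapply is_derive_on_unique; eauto.
Qed.

Lemma is_derive_on_interior (a b : R) (f : R -> R) (x l : R) : a < x < b ->
  is_derive_on (Icc a b) f x l -> is_derive f x l.
Proof.
  intros Hx [Hl H]. split; auto. intros x' Hx' eps.
  assert (Hlim : is_filter_lim (within (Icc a b) (locally x)) x').
  { intros P HP. apply filter_le_within. auto. }
  assert (HI : locally x (Icc a b)).
  { apply (locally_interval _ x a b); simpl; try lra.
    intros y Hy1 Hy2. simpl in *. unfold Icc. lra. }
  pose proof (H x' Hlim eps) as HW. unfold within in HW.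
  generalize (filter_and _ _ HW HI). apply filter_imp.
  intros y [Hy1 Hy2]. exact (Hy1 Hy2).
Qed.

Lemma ex_derive_on_continuous (I : R -> Prop) (f : R -> R) (x : R) :
  ex_derive_on I f x -> filterlim f (within I (locally x)) (locally (f x)).
Proof.
  intros [l Hl]. apply filterlim_locally. intros eps.
  destruct (is_derive_on_eps I f x l Hl 1 ltac:(lra)) as [d [Hd H]].
  assert (Hd' : 0 < Rmin d (eps / (Rabs l + 1))).
  { apply Rmin_glb_lt; auto. apply Rdiv_lt_0_compat; [apply cond_pos|].
    pose proof (Rabs_pos l). lra. }
  exists (mkposreal _ Hd'). intros y Hy HIy.
  assert (Hyx : Rabs (y - x) < Rmin d (eps / (Rabs l + 1))) by exact Hy.
  pose proof (Rmin_l d (eps / (Rabs l + 1))). pose proof (Rmin_r d (eps / (Rabs l + 1))).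
  specialize (H y HIy ltac:(lra)).
  change (Rabs (f y - f x) < eps).
  replace (f y - f x) with ((f y - f x - (y - x) * l) + (y - x) * l) by ring.
  eapply Rle_lt_trans; [apply Rabs_triang|]. rewrite Rabs_mult.
  pose proof (Rabs_pos l).
  apply Rle_lt_trans with (Rabs (y - x) * (Rabs l + 1)); [lra|].
  apply Rlt_div_r; lra.
Qed.

(** ** Extension by constants *)

Definition clamp (a b y : R) : R := Rmax a (Rmin b y).

Lemma clamp_id (a b y : R) : a <= y <= b -> clamp a b y = y.
Proof. intros H. unfold clamp. rewrite Rmin_right, Rmax_right; lra. Qed.

Lemma clamp_Icc (a b y : R) : a <= b -> Icc a b (clamp a b y).
Proof.
  intros H. unfold clamp, Icc. split; [apply Rmax_l|].
  apply Rmax_lub; auto. apply Rmin_l.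
Qed.

Lemma clamp_contract (a b x y : R) : Rabs (clamp a b y - clamp a b x) <= Rabs (y - x).
Proof.
  unfold clamp, Rmin. destruct (Rle_dec b y), (Rle_dec b x);
    unfold Rmax; repeat match goal with |- context [Rle_dec ?a ?b] => destruct (Rle_dec a b) end;
    unfold Rabs; repeat match goal with |- context [Rcase_abs ?a] => destruct (Rcase_abs a) end;
    lra.
Qed.

Lemma continuity_clamp (a b : R) (g : R -> R) (x : R) : a <= b ->
  continuous_on (Icc a b) g -> continuity_pt (fun y => g (clamp a b y)) x.
Proof.
  intros Hab Hg. apply continuity_pt_filterlim, filterlim_locally. intros eps.
  destruct (Hg (clamp a b x) (clamp_Icc a b x Hab) (ball (g (clamp a b x)) eps)) as [d Hd].
  { apply locally_ball. }
  exists d. intros y Hy. apply (Hd (clamp a b y)); [|apply clamp_Icc; auto].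
  eapply Rle_lt_trans; [apply clamp_contract|]. exact Hy.
Qed.

Lemma bounded_continuous_on (a b : R) (g : R -> R) : a <= b ->
  continuous_on (Icc a b) g -> exists M, forall x, a <= x <= b -> Rabs (g x) <= M.
Proof.
  intros Hab Hg.
  destruct (continuity_ab_maj (fun y => Rabs (g (clamp a b y))) a b Hab) as [c [Hc _]].
  { intros y _. apply (continuity_pt_comp (fun y => g (clamp a b y)) Rabs).
    - apply continuity_clamp; auto.
    - apply Rcontinuity_abs. }
  exists (Rabs (g (clamp a b c))). intros x Hx.
  specialize (Hc x Hx). simpl in Hc. rewrite (clamp_id a b x) in Hc by auto. exact Hc.
Qed.

Lemma C_pw_bounded (a b : R) (g : R -> R) : C_pw a b g ->
  exists (B : list R) (M : R), forall x, a <= x <= b -> ~ In x B -> Rabs (g x) <= M.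
Proof.
  intros [N [s [H0 [HN [Hs Hh]]]]]. subst a b.
  cut (forall k, (k <= N)%nat -> exists (B : list R) (M : R),
    forall x, s 0%nat <= x <= s k -> ~ In x B -> Rabs (g x) <= M).
  { intros H. apply (H N). lia. }
  induction k as [|k IH]; intros Hk.
  - exists (s 0%nat :: nil), 0. intros x Hx Hno. exfalso. apply Hno. left. lra.
  - destruct (IH ltac:(lia)) as [B [M HM]].
    destruct (Hh k ltac:(lia)) as [h [Hc Hg]].
    specialize (Hs k ltac:(lia)).
    destruct (bounded_continuous_on (s k) (s (S k)) h ltac:(lra) Hc) as [M' HM'].
    exists (s (S k) :: B), (Rmax M M'). intros x Hx Hno.
    destruct (Rle_lt_dec x (s k)) as [Hxk|Hxk].
    + eapply Rle_trans; [apply HM; [lra|]|apply Rmax_l]. intros Hin. apply Hno. right. auto.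
    + eapply Rle_trans; [|apply Rmax_r]. rewrite <- Hg.
      * apply HM'. lra.
      * split; auto. destruct (Rtotal_order x (s (S k))) as [|[E|]]; auto; [|lra].
        exfalso. apply Hno. left. auto.
Qed.

(** * The regularity class of [f] *)

(** The derivatives of [f] within [[0, 1]], extended by constants so that the
    two-sided notions of continuity apply at the endpoints. *)
Definition dext (f : R -> R) (i : nat) (y : R) : R :=
  Derive_n_on (Icc 0 1) f i (clamp 0 1 y).

Lemma dext_is_derive (f : R -> R) (i : nat) (x : R) : 0 < x < 1 ->
  ex_derive_on (Icc 0 1) (Derive_n_on (Icc 0 1) f i) x ->
  is_derive (dext f i) x (dext f (S i) x).
Proof.
  intros Hx Hd. unfold dext at 2. rewrite clamp_id by lra. simpl.
  apply is_derive_ext_loc with (Derive_n_on (Icc 0 1) f i).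
  - apply (locally_interval _ x 0 1); simpl; try lra.
    intros y Hy0 Hy1. simpl in *. unfold dext. rewrite clamp_id by lra. reflexivity.
  - apply (is_derive_on_interior 0 1); auto.
    apply Derive_on_correct; auto; unfold Icc; lra.
Qed.

Lemma C_r_tower (r : nat) (f : R -> R) : C_r r 0 1 f ->
  tower r (dext f) 0 1 /\ forall i y, (i <= r)%nat -> continuity_pt (dext f i) y.
Proof.
  intros [Hd Hc].
  assert (Hcont : forall i y, (i <= r)%nat -> continuity_pt (dext f i) y).
  { intros i y Hi. apply continuity_clamp; [lra|].
    destruct (Nat.eq_dec i r) as [->|Hne]; auto.
    intros x Hx. apply ex_derive_on_continuous, Hd; auto. lia. }
  split; auto. split; intros i y Hi Hy.
  - apply Hcont. lia.
  - apply dext_is_derive; auto. apply Hd; auto. unfold Icc. lra.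
Qed.

(** The order [r + 2] derivative is bounded off a finite set, hence so is the
    one of order [r + 1], being Lipschitz between consecutive exceptional
    points; hence the one of order [r], being continuous, is Lipschitz on the
    whole interval. *)
Lemma D_r1_lipschitz (r : nat) (f : R -> R) : D_r1 r 0 1 f ->
  exists (B : list R) (M : R), 0 <= M /\
    (forall x y, 0 <= x -> x <= y -> y <= 1 ->
       Rabs (dext f r y - dext f r x) <= M * (y - x)) /\
    (forall x y, 0 <= x -> x <= y -> y <= 1 -> (forall t, In t B -> ~ (x <= t <= y)) ->
       (forall z, x <= z <= y -> is_derive (dext f r) z (dext f (S r) z)) /\
       Rabs (dext f (S r) y - dext f (S r) x) <= M * (y - x)).
Proof.
  intros [HC [[e He] Hpw]].
  destruct (C_r_tower r f HC) as [_ Hcont].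
  destruct (C_pw_bounded _ _ _ Hpw) as [B0 [M0 HM0]].
  set (B := 0 :: 1 :: e ++ B0).
  assert (Hin : forall x y z, 0 <= x -> y <= 1 -> (forall t, In t B -> ~ (x <= t <= y)) ->
    x <= z <= y -> 0 < z < 1 /\ ~ In z e /\ ~ In z B0).
  { intros x y z Hx Hy Hno Hz.
    assert (Hz0 : z <> 0) by (intros ->; apply (Hno 0); [left; reflexivity|lra]).
    assert (Hz1 : z <> 1) by (intros ->; apply (Hno 1); [right; left; reflexivity|lra]).
    split; [lra|]. split; intros Hi; apply (Hno z); auto; right; right; apply in_or_app; auto. }
  assert (Hder : forall x y i z, (i < r + 2)%nat -> 0 <= x -> y <= 1 ->
    (forall t, In t B -> ~ (x <= t <= y)) -> x <= z <= y ->
    is_derive (dext f i) z (dext f (S i) z)).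
  { intros x y i z Hi Hx Hy Hno Hz. destruct (Hin x y z Hx Hy Hno Hz) as [Hz1 [Hz2 _]].
    apply dext_is_derive; auto. apply He; auto. unfold Icc. lra. }
  assert (Hct : forall F z l, is_derive F z l -> continuity_pt F z).
  { intros F z l HF. apply continuity_pt_filterlim, (ex_derive_continuous (V := R_NormedModule)).
    exists l. exact HF. }
  assert (H1 : forall x y, 0 <= x -> x <= y -> y <= 1 -> (forall t, In t B -> ~ (x <= t <= y)) ->
    Rabs (dext f (S r) y - dext f (S r) x) <= Rabs M0 * (y - x)).
  { intros x y Hx Hxy Hy Hno. apply (mean_value_bound _ (dext f (S (S r)))); auto.
    - intros z Hz. apply (Hder x y); auto; try lia; lra.
    - intros z Hz. eapply Hct, (Hder x y); auto; lia.
    - intros z Hz. destruct (Hin x y z Hx Hy Hno Hz) as [Hz1 [_ Hz2]].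
      unfold dext. rewrite clamp_id by lra.
      eapply Rle_trans; [|apply Rle_abs].
      replace (S (S r)) with (r + 2)%nat by lia. apply HM0; auto. lra. }
  destruct (bounded_off_list B (dext f (S r)) (Rabs M0) 0 1) as [M1 HM1].
  { intros x y Hx Hxy Hy Hno. apply H1; auto; lra. }
  exists B, (Rabs M0 + Rabs M1).
  pose proof (Rabs_pos M0). pose proof (Rabs_pos M1).
  split; [lra|]. split.
  - intros x y Hx Hxy Hy. apply Rle_trans with (Rabs M1 * (y - x)).
    2:{ apply Rmult_le_compat_r; lra. }
    apply (lipschitz_off_list B); auto.
    intros x' y' Hx' Hxy' Hy' Hno.
    apply (mean_value_bound _ (dext f (S r))); auto.
    + intros z Hz. apply (Hder x' y'); auto; try lia; lra.
    + intros z Hz. destruct (Hin x' y' z ltac:(lra) ltac:(lra) Hno Hz) as [Hz1 _].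
      eapply Rle_trans; [|apply Rle_abs]. apply HM1; auto.
      intros Hi. exact (Hno z Hi Hz).
  - intros x y Hx Hxy Hy Hno. split.
    + intros z Hz. apply (Hder x y); auto. lia.
    + eapply Rle_trans; [apply H1; auto|]. apply Rmult_le_compat_r; lra.
Qed.

(** On every stencil, [r] differences act as derivatives and the last two are
    bounded by the Lipschitz constant of the order [r] derivative, which gains
    one factor [h]; away from the break points one more difference acts as a
    derivative, and the Lipschitz constant of the order [r + 1] derivative
    gains another one. *)
Lemma D_r1_diff_piecewise (r : nat) (f : R -> R) : D_r1 r 0 1 f -> diff_piecewise r f.
Proof.
  intros Hf. destruct (D_r1_lipschitz r f Hf) as [B [M [HM [HL1 HL2]]]].
  destruct (C_r_tower r f (proj1 Hf)) as [Ht Hcont].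
  exists B, (2 * M). split; [lra|]. intros N j HN Hj HjN.
  pose proof (lt_0_INR N ltac:(lia)) as HN'.
  set (h := / INR N). set (x := IZR j / INR N). set (m := (r + 2)%nat) in *.
  assert (Hh : 0 < h) by (apply Rinv_0_lt_compat; auto).
  assert (Hx0 : 0 <= x) by (apply Rdiv_le_0_compat; auto; apply IZR_le; auto).
  assert (Hxm : IZR (j + Z.of_nat m) / INR N = x + INR m * h).
  { rewrite plus_IZR, <- INR_IZR_INZ. unfold x, h. field. lra. }
  assert (Hx1 : x + INR m * h <= 1).
  { rewrite <- Hxm. apply Rle_div_l; auto. rewrite Rmult_1_l, INR_IZR_INZ. apply IZR_le. auto. }
  assert (Hmr : INR m = INR r + 2) by (unfold m; rewrite plus_INR; reflexivity).
  pose proof (pos_INR r) as Hr.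
  rewrite Hmr in Hx1.
  rewrite (fdiff_ext_stencil m h f (dext f 0) x); [|lra|].
  2:{ intros y Hy. rewrite Hmr in Hy. unfold dext. simpl. rewrite clamp_id; [reflexivity|].
      split; lra. }
  assert (Hpow : forall k c, c / INR N ^ k = h ^ k * c)
    by (intros k c; unfold h; rewrite pow_inv; unfold Rdiv; ring).
  rewrite !Hpow, Hxm. split.
  - replace (h ^ (r + 1) * (2 * M)) with (h ^ r * (2 * M * h))
      by (rewrite pow_add; simpl; ring).
    replace m with (S (S r)) by (unfold m; lia).
    change (fdiff (S (S r)) h (dext f 0) x) with (fdiff r h (delta h (delta h (dext f 0))) x).
    apply (fdiff_bound r (fun i => delta h (delta h (dext f i)))); [lra| |].
    + apply (tower_delta r (fun i => delta h (dext f i))); [lra|].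
      apply tower_delta; [lra|]. revert Ht. apply tower_restrict; [lia|lra|lra].
    + intros y Hy. unfold delta.
      pose proof (HL1 y (y + h) ltac:(lra) ltac:(lra) ltac:(lra)) as E1.
      pose proof (HL1 (y + h) (y + h + h) ltac:(lra) ltac:(lra) ltac:(lra)) as E2.
      replace (y + h - y) with h in E1 by ring.
      replace (y + h + h - (y + h)) with h in E2 by ring.
      eapply Rle_trans; [apply Rabs_triang|]. rewrite Rabs_Ropp. lra.
  - intros Hno. rewrite Hmr in Hno.
    assert (Hno' : forall u v, x <= u -> v <= x + (INR r + 2) * h ->
                     forall t, In t B -> ~ (u <= t <= v)).
    { intros u v Hu Hv t Ht' Hin. apply (Hno t Ht'). lra. }
    replace (h ^ m * (2 * M)) with (h ^ S r * (2 * M * h))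
      by (unfold m; rewrite pow_add; simpl; ring).
    replace m with (S (S r)) by (unfold m; lia).
    change (fdiff (S (S r)) h (dext f 0) x) with (fdiff (S r) h (delta h (dext f 0)) x).
    apply (fdiff_bound (S r) (fun i => delta h (dext f i))); [lra| |].
    + apply tower_delta; [lra|]. rewrite S_INR. split; intros i y Hi Hy.
      * apply Hcont. lia.
      * destruct (Nat.eq_dec i r) as [->|Hne].
        -- apply (HL2 y y); try lra. apply Hno'; lra.
        -- apply Ht; [lia|lra].
    + rewrite S_INR. intros y Hy. unfold delta.
      destruct (HL2 y (y + h)) as [_ E]; try lra; [apply Hno'; lra|].
      replace (y + h - y) with h in E by ring.
      assert (0 <= M * h) by (apply Rmult_le_pos; lra). lra.
Qed.

Lemma D_r1_continuous (r : nat) (f : R -> R) : D_r1 r 0 1 f -> continuous_on (Icc 0 1) f.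
Proof.
  intros [[Hd Hc] _]. destruct r as [|r]; auto.
  intros x Hx. apply ex_derive_on_continuous, (Hd 0%nat); auto. lia.
Qed.

(** The expansion at [1] is the expansion at [0] of [y |-> f (1 - y)]. *)
Lemma D_r1_taylor (r : nat) (f : R -> R) : D_r1 r 0 1 f ->
  exists L, 0 <= L /\ forall y, 0 <= y <= 1 ->
    Rabs (f y - sum_n (fun i => Derive_n_on (Icc 0 1) f i 0 / INR (fact i) * y ^ i) r)
      <= L * y ^ (r + 1) /\
    Rabs (f (1 - y) - sum_n (fun i => (-1) ^ i * Derive_n_on (Icc 0 1) f i 1
                                      / INR (fact i) * y ^ i) r)
      <= L * y ^ (r + 1).
Proof.
  intros Hf. destruct (D_r1_lipschitz r f Hf) as [B [M [HM [HL _]]]].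
  destruct (C_r_tower r f (proj1 Hf)) as [Ht Hcont].
  assert (E0 : clamp 0 1 0 = 0) by (apply clamp_id; lra).
  assert (E1 : clamp 0 1 1 = 1) by (apply clamp_id; lra).
  exists M. split; auto. intros y Hy. split.
  - pose proof (taylor_bound r (dext f) M Ht) as H.
    replace (f y) with (dext f 0 y) by (unfold dext; simpl; rewrite clamp_id; auto).
    erewrite sum_n_ext; [apply H; auto|].
    + intros z Hz. pose proof (HL 0 z ltac:(lra) ltac:(lra) ltac:(lra)) as HL'.
      rewrite Rminus_0_r in HL'. exact HL'.
    + intros i. unfold dext. rewrite E0. reflexivity.
  - pose proof (taylor_bound r (fun i z => (-1) ^ i * dext f i (1 - z)) M) as H.
    replace (f (1 - y)) with ((-1) ^ 0 * dext f 0 (1 - y)).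
    2:{ unfold dext. simpl. rewrite clamp_id by lra. ring. }
    erewrite sum_n_ext; [apply H; auto|].
    + split; intros i z Hi Hz.
      * apply continuity_pt_mult; [apply continuity_pt_const; intros ? ?; reflexivity|].
        apply (continuity_pt_comp (fun z => 1 - z) (dext f i)).
        -- apply continuity_pt_minus; [apply continuity_pt_const; intros ? ?; reflexivity|].
           apply continuity_pt_id.
        -- apply Hcont. lia.
      * destruct Ht as [_ Hd]. specialize (Hd i (1 - z) Hi ltac:(lra)).
        replace ((-1) ^ S i * dext f (S i) (1 - z))
          with (scal ((-1) ^ i) (scal (-1) (dext f (S i) (1 - z))))
          by (unfold scal; simpl; unfold mult; simpl; ring).
        apply (is_derive_scal (fun z => dext f i (1 - z))).
        apply (is_derive_comp (dext f i) (fun z => 1 - z)); auto.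
        auto_derive; auto.
    + intros z Hz. pose proof (HL (1 - z) 1 ltac:(lra) ltac:(lra) ltac:(lra)) as HL'.
      rewrite <- Rmult_minus_distr_l, Rabs_mult, pow_1_abs, Rmult_1_l, Rminus_0_r.
      rewrite Rabs_minus_sym. replace (1 - (1 - z)) with z in HL' by ring. exact HL'.
    + intros i. unfold dext. rewrite Rminus_0_r, E1. reflexivity.
Qed.

(** * The Hermite continuation *)

(** The Hermite polynomials with a single nonzero datum, the derivative of order
    [m] at [0], respectively at [-1]. *)
Definition hermite_left (r m : nat) (x : R) : R :=
  (1 + x) ^ (r + 1) *
  (/ INR (fact m) *
   sum_n (fun q => (-1) ^ q * Binomial.C (r + q) q * x ^ (m + q)) (r - m)).

Definition hermite_right (r m : nat) (x : R) : R :=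
  (- x) ^ (r + 1) *
  (/ INR (fact m) *
   sum_n (fun q => Binomial.C (r + q) q * (1 + x) ^ (m + q)) (r - m)).

Definition hermite (r : nat) (al be : nat -> R) (x : R) : R :=
  sum_n (fun m => al m * hermite_left r m x) r
  + sum_n (fun m => be m * hermite_right r m x) r.

Lemma sum_n_scal (c : R) (u : nat -> R) (n : nat) :
  sum_n (fun i => c * u i) n = c * sum_n u n.
Proof. apply (sum_n_mult_l (K := R_Ring)). Qed.

(** Stated with the operations of [R], for [ring] to recognize them. *)
Lemma sum_n_ext_R (u v : nat -> R) (n : nat) :
  (forall i, u i = v i) -> sum_n u n = sum_n v n.
Proof. apply sum_n_ext. Qed.

Lemma sum_n_S_R (u : nat -> R) (n : nat) : sum_n u (S n) = sum_n u n + u (S n).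
Proof. rewrite sum_Sn. reflexivity. Qed.

Lemma Hermite_P_hermite (r : nat) (A : @matrix R 2 (S r)) (x : R) :
  Hermite_P A x = hermite r (coeff_mat 0 A 0) (coeff_mat 0 A 1) x.
Proof.
  unfold Hermite_P, hermite, hermite_left, hermite_right.
  apply f_equal2; rewrite <- sum_n_scal; apply sum_n_ext_R; intros m; unfold Rdiv; ring.
Qed.

(** The symmetry [x |-> - 1 - x] exchanges the two junctions, so that only the
    behaviour at [0] has to be studied. *)
Lemma hermite_right_reflect (r m : nat) (x : R) :
  hermite_right r m x = (-1) ^ m * hermite_left r m (- 1 - x).
Proof.
  unfold hermite_left, hermite_right.
  replace (1 + (- 1 - x)) with (- x) by ring.
  match goal with |- ?a * (?b * ?c) = ?s * (?a * (?b * ?d)) =>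
    replace c with (s * d); [ring|] end.
  rewrite <- sum_n_scal. apply sum_n_ext_R. intros q.
  replace (- 1 - x) with (-1 * (1 + x)) by ring.
  rewrite Rpow_mult_distr, (pow_add (-1)).
  assert (E : (-1) ^ m * (-1) ^ q * ((-1) ^ m * (-1) ^ q) = 1)
    by (rewrite <- pow_add, <- Rpow_mult_distr; replace (-1 * -1) with 1 by ring; apply pow1).
  transitivity ((-1) ^ m * (-1) ^ q * ((-1) ^ m * (-1) ^ q)
                * (Binomial.C (r + q) q * (1 + x) ^ (m + q))); [|rewrite E]; ring.
Qed.

Lemma hermite_right_at_reflected (r m : nat) (y : R) :
  hermite_right r m (- 1 - y) = (-1) ^ m * hermite_left r m y.
Proof. rewrite hermite_right_reflect. do 2 f_equal. ring. Qed.

(** The partial sums of the binomial series of [(1 + x)^-(r+1)]. *)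
Definition binom_series (r K : nat) (x : R) : R :=
  sum_n (fun q => (-1) ^ q * Binomial.C (r + q) q * x ^ q) K.

Lemma binomial_diag (r q : nat) :
  Binomial.C (S r + S q) (S q) = Binomial.C (S r + q) q + Binomial.C (r + S q) (S q).
Proof.
  replace (S r + S q)%nat with (S (S r + q)) by lia.
  rewrite <- pascal by lia. do 2 f_equal. lia.
Qed.

Lemma binomial_0_r (n : nat) : Binomial.C n 0 = 1.
Proof.
  unfold Binomial.C. rewrite Nat.sub_0_r. simpl (fact 0). simpl (INR 1).
  field. apply INR_fact_neq_0.
Qed.

Lemma binomial_n_n (n : nat) : Binomial.C n n = 1.
Proof.
  unfold Binomial.C. rewrite Nat.sub_diag. simpl (fact 0). simpl (INR 1).
  field. apply INR_fact_neq_0.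
Qed.

(** Pascal's rule: multiplication by [1 + x] lowers the exponent of the series by
    one, up to the truncation term. *)
Lemma binom_series_step (r K : nat) (x : R) :
  (1 + x) * binom_series (S r) K x
  = binom_series r K x + (-1) ^ K * Binomial.C (S r + K) K * x ^ (K + 1).
Proof.
  unfold binom_series. induction K as [|K IH].
  - rewrite !sum_O, !binomial_0_r. simpl. ring.
  - rewrite !sum_n_S_R.
    rewrite Rmult_plus_distr_l, IH, binomial_diag.
    replace (x ^ (S K + 1)) with (x * x ^ (K + 1)) by (simpl; ring).
    replace (x ^ S K) with (x ^ (K + 1)) by (f_equal; lia).
    simpl pow. ring.
Qed.

Lemma binom_series_0 (K : nat) (x : R) :
  (1 + x) * binom_series 0 K x = 1 + (-1) ^ K * x ^ (K + 1).
Proof.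
  unfold binom_series. induction K as [|K IH].
  - rewrite sum_O, binomial_0_r. simpl. ring.
  - rewrite sum_n_S_R.
    rewrite Rmult_plus_distr_l, IH. rewrite Nat.add_0_l, binomial_n_n.
    replace (x ^ (S K + 1)) with (x * x ^ (K + 1)) by (simpl; ring).
    replace (x ^ S K) with (x ^ (K + 1)) by (f_equal; lia).
    simpl pow. ring.
Qed.

(** This identity is the reason for the form of the Hermite polynomial: the
    factor [(1 + x)^(r+1)] makes it flat at [-1], and the truncated series
    compensates that factor at [0]. *)
Lemma binom_series_inverse (r K : nat) : exists C, 0 <= C /\ forall x, 0 <= x <= 1 ->
  Rabs ((1 + x) ^ (r + 1) * binom_series r K x - 1) <= C * x ^ (K + 1).
Proof.
  induction r as [|r [C [HC IH]]].
  - exists 1. split; [lra|]. intros x Hx. simpl (0 + 1)%nat. rewrite pow_1, binom_series_0.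
    replace (1 + (-1) ^ K * x ^ (K + 1) - 1) with ((-1) ^ K * x ^ (K + 1)) by ring.
    rewrite Rabs_mult, pow_1_abs, Rabs_pos_eq by (apply pow_le; lra). lra.
  - set (c := Rabs (Binomial.C (S r + K) K)).
    exists (C + 2 ^ (r + 1) * c).
    assert (H2 : 0 <= 2 ^ (r + 1)) by (apply pow_le; lra).
    assert (Hc : 0 <= c) by apply Rabs_pos.
    split; [apply Rplus_le_le_0_compat; auto; apply Rmult_le_pos; auto|].
    intros x Hx. specialize (IH x Hx).
    replace ((1 + x) ^ (S r + 1) * binom_series (S r) K x - 1) with
      (((1 + x) ^ (r + 1) * binom_series r K x - 1)
       + (1 + x) ^ (r + 1) * ((-1) ^ K * Binomial.C (S r + K) K * x ^ (K + 1))).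
    2:{ replace ((1 + x) ^ (S r + 1)) with ((1 + x) ^ (r + 1) * (1 + x)) by (simpl; ring).
        rewrite (Rmult_assoc _ (1 + x)), binom_series_step. ring. }
    eapply Rle_trans; [apply Rabs_triang|]. rewrite Rmult_plus_distr_r.
    apply Rplus_le_compat; auto.
    assert (Hx0 : 0 <= x ^ (K + 1)) by (apply pow_le; lra).
    rewrite !Rabs_mult, pow_1_abs, (Rabs_pos_eq (x ^ _)) by auto. fold c.
    rewrite Rmult_1_l, Rmult_assoc.
    apply Rmult_le_compat_r; [apply Rmult_le_pos; auto|].
    rewrite Rabs_pos_eq by (apply pow_le; lra). apply pow_incr. lra.
Qed.

Lemma hermite_left_near_0 (r m : nat) : (m <= r)%nat -> exists C, 0 <= C /\ forall y, 0 <= y <= 1 ->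
  Rabs (hermite_left r m y - / INR (fact m) * y ^ m) <= C * y ^ (r + 1).
Proof.
  intros Hm. destruct (binom_series_inverse r (r - m)) as [C [HC H]].
  pose proof (Rinv_0_lt_compat _ (INR_fact_lt_0 m)) as Hf.
  exists (/ INR (fact m) * C). split; [apply Rmult_le_pos; lra|].
  intros y Hy. specialize (H y Hy).
  replace (hermite_left r m y - / INR (fact m) * y ^ m)
    with (/ INR (fact m) * (y ^ m * ((1 + y) ^ (r + 1) * binom_series r (r - m) y - 1))).
  - assert (0 <= y ^ m) by (apply pow_le; lra).
    rewrite !Rabs_mult, (Rabs_pos_eq (/ _)), (Rabs_pos_eq (y ^ m)), Rmult_assoc by lra.
    apply Rmult_le_compat_l; [lra|].
    replace (r + 1)%nat with (m + (r - m + 1))%nat at 2 by lia.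
    rewrite (pow_add y m).
    replace (C * (y ^ m * y ^ (r - m + 1))) with (y ^ m * (C * y ^ (r - m + 1))) by ring.
    apply Rmult_le_compat_l; auto.
  - unfold hermite_left.
    replace (sum_n (fun q => (-1) ^ q * Binomial.C (r + q) q * y ^ (m + q)) (r - m))
      with (y ^ m * binom_series r (r - m) y); [ring|].
    unfold binom_series. rewrite <- sum_n_scal. apply sum_n_ext_R. intros q.
    rewrite pow_add. ring.
Qed.

Lemma hermite_right_factor_smooth (r m : nat) :
  diff_smooth (fun x => / INR (fact m) *
    sum_n (fun q => Binomial.C (r + q) q * (1 + x) ^ (m + q)) (r - m)).
Proof.
  apply diff_smooth_scal, diff_smooth_sum_n. intros q. apply diff_smooth_scal.
  apply diff_smooth_ext with (fun y => (1 + y) ^ (m + q) * 1); [intros; ring|].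
  apply diff_smooth_mul_affine, diff_smooth_const.
Qed.

Lemma hermite_right_smooth (r m : nat) : diff_smooth (hermite_right r m).
Proof.
  apply diff_smooth_ext with (fun x => (-1) ^ (r + 1) * ((0 + x) ^ (r + 1) *
    (/ INR (fact m) * sum_n (fun q => Binomial.C (r + q) q * (1 + x) ^ (m + q)) (r - m)))).
  - intros x. unfold hermite_right. rewrite <- Rmult_assoc, <- Rpow_mult_distr.
    do 2 f_equal. ring.
  - apply diff_smooth_scal, diff_smooth_mul_affine, hermite_right_factor_smooth.
Qed.

Lemma hermite_left_smooth (r m : nat) : diff_smooth (hermite_left r m).
Proof.
  apply diff_smooth_mul_affine, diff_smooth_scal, diff_smooth_sum_n.
  intros q. apply diff_smooth_scal.
  apply diff_smooth_ext with (fun y => (0 + y) ^ (m + q) * 1).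
  - intros y. rewrite Rplus_0_l. ring.
  - apply diff_smooth_mul_affine, diff_smooth_const.
Qed.

Lemma hermite_smooth (r : nat) (al be : nat -> R) : diff_smooth (hermite r al be).
Proof.
  apply diff_smooth_plus; apply diff_smooth_sum_n; intros m; apply diff_smooth_scal;
    auto using hermite_left_smooth, hermite_right_smooth.
Qed.

Lemma hermite_right_near_0 (r m : nat) : exists C, 0 <= C /\ forall y, 0 <= y <= 1 ->
  Rabs (hermite_right r m y) <= C * y ^ (r + 1).
Proof.
  destruct (hermite_right_factor_smooth r m 0%nat 1) as [C [HC H]].
  exists C. split; auto. intros y Hy.
  specialize (H y 0 ltac:(rewrite Rabs_pos_eq; lra) ltac:(lra)).
  simpl fdiff in H. rewrite Rmult_1_r in H.
  unfold hermite_right. rewrite Rabs_mult, <- RPow_abs, Rabs_Ropp, (Rabs_pos_eq y) by lra.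
  rewrite (Rmult_comm C). apply Rmult_le_compat_l; auto. apply pow_le. lra.
Qed.

Lemma Rabs_sign_mult (m : nat) (z : R) : Rabs ((-1) ^ m * z) = Rabs z.
Proof. rewrite Rabs_mult, pow_1_abs. ring. Qed.

Lemma sum_n_near (u v : nat -> R -> R) (k : nat) (n : nat) :
  (forall m, (m <= n)%nat -> exists C, 0 <= C /\ forall y, 0 <= y <= 1 ->
     Rabs (u m y - v m y) <= C * y ^ k) ->
  exists C, 0 <= C /\ forall y, 0 <= y <= 1 ->
     Rabs (sum_n (fun m => u m y) n - sum_n (fun m => v m y) n) <= C * y ^ k.
Proof.
  induction n as [|n IH]; intros H.
  - destruct (H 0%nat ltac:(lia)) as [C [HC HB]]. exists C. split; auto.
    intros y Hy. rewrite !sum_O. auto.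
  - destruct IH as [C1 [HC1 HB1]]; [auto|].
    destruct (H (S n) ltac:(lia)) as [C2 [HC2 HB2]]. exists (C1 + C2). split; [lra|].
    intros y Hy. rewrite !sum_n_S_R.
    specialize (HB1 y Hy). specialize (HB2 y Hy).
    match goal with |- Rabs (?a + ?b - (?c + ?d)) <= _ =>
      replace (a + b - (c + d)) with ((a - c) + (b - d)) by ring end.
    eapply Rle_trans; [apply Rabs_triang|]. lra.
Qed.

(** The part that carries the data at [-1] is flat at [0]. *)
Lemma hermite_taylor (r : nat) (al be : nat -> R) :
  exists C, 0 <= C /\ forall y, 0 <= y <= 1 ->
    Rabs (hermite r al be y - sum_n (fun m => al m / INR (fact m) * y ^ m) r)
      <= C * y ^ (r + 1).
Proof.
  destruct (sum_n_near (fun m y => al m * hermite_left r m y)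
              (fun m y => al m / INR (fact m) * y ^ m) (r + 1) r) as [C1 [HC1 H1]].
  { intros m Hm. destruct (hermite_left_near_0 r m Hm) as [C [HC H]].
    exists (Rabs (al m) * C). split; [apply Rmult_le_pos; auto using Rabs_pos|].
    intros y Hy. unfold Rdiv. rewrite Rmult_assoc, <- Rmult_minus_distr_l, Rabs_mult, Rmult_assoc.
    apply Rmult_le_compat_l; auto using Rabs_pos. }
  destruct (sum_n_near (fun m y => be m * hermite_right r m y)
              (fun m y => 0 * y) (r + 1) r) as [C2 [HC2 H2]].
  { intros m Hm. destruct (hermite_right_near_0 r m) as [C [HC H]].
    exists (Rabs (be m) * C). split; [apply Rmult_le_pos; auto using Rabs_pos|].
    intros y Hy. rewrite Rmult_0_l, Rminus_0_r, Rabs_mult, Rmult_assoc.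
    apply Rmult_le_compat_l; auto using Rabs_pos. }
  exists (C1 + C2). split; [lra|]. intros y Hy. specialize (H1 y Hy). specialize (H2 y Hy).
  rewrite sum_n_scal, Rmult_0_l, Rminus_0_r in H2.
  unfold hermite.
  match goal with |- Rabs (?a + ?b - ?c) <= _ => replace (a + b - c) with ((a - c) + b) by ring end.
  eapply Rle_trans; [apply Rabs_triang|]. lra.
Qed.

Lemma hermite_reflect (r : nat) (al be : nat -> R) (y : R) :
  hermite r al be (- 1 - y)
  = hermite r (fun m => (-1) ^ m * be m) (fun m => (-1) ^ m * al m) y.
Proof.
  unfold hermite. rewrite Rplus_comm. f_equal; apply sum_n_ext_R; intros m.
  - rewrite hermite_right_at_reflected. ring.
  - rewrite hermite_right_reflect.
    assert (E : (-1) ^ m * (-1) ^ m = 1)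
      by (rewrite <- Rpow_mult_distr; replace (-1 * -1) with 1 by ring; apply pow1).
    transitivity ((-1) ^ m * (-1) ^ m * (al m * hermite_left r m (- 1 - y)));
      [rewrite E|]; ring.
Qed.

(** Both sides have the Taylor polynomial given by the data, at [0] and, after
    reflection, at [1]. *)
Lemma hermite_contact (r : nat) (f : R -> R) : D_r1 r 0 1 f ->
  contact r f (hermite r (fun m => Derive_n_on (Icc 0 1) f m 0)
                         (fun m => Derive_n_on (Icc 0 1) f m 1)).
Proof.
  intros Hf. destruct (D_r1_taylor r f Hf) as [L [HL HT]].
  set (al := fun m => Derive_n_on (Icc 0 1) f m 0).
  set (be := fun m => Derive_n_on (Icc 0 1) f m 1).
  destruct (hermite_taylor r al be) as [C1 [HC1 H1]].
  destruct (hermite_taylor r (fun m => (-1) ^ m * be m) (fun m => (-1) ^ m * al m))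
    as [C2 [HC2 H2]].
  exists (L + C1 + C2). split; [lra|]. intros y Hy.
  destruct (HT y Hy) as [T1 T2]. specialize (H1 y Hy). specialize (H2 y Hy).
  assert (Hyr : 0 <= y ^ (r + 1)) by (apply pow_le; lra).
  assert (P1 : 0 <= C1 * y ^ (r + 1)) by (apply Rmult_le_pos; auto).
  assert (P2 : 0 <= C2 * y ^ (r + 1)) by (apply Rmult_le_pos; auto).
  rewrite Rabs_minus_sym in H1. rewrite Rabs_minus_sym in H2.
  split.
  - match type of T1 with Rabs (_ - ?t) <= _ =>
      replace (f y - hermite r al be y) with ((f y - t) + (t - hermite r al be y)) by ring end.
    eapply Rle_trans; [apply Rabs_triang|].
    assert (H1' := H1). unfold al at 1 in H1'. lra.
  - replace (-1 - y) with (- 1 - y) by ring. rewrite hermite_reflect.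
    match type of T2 with Rabs (_ - ?t) <= _ =>
      match goal with |- Rabs (?a - ?b) <= _ =>
        replace (a - b) with ((a - t) + (t - b)) by ring end end.
    eapply Rle_trans; [apply Rabs_triang|].
    assert (H2' := H2). unfold be at 1 in H2'. lra.
Qed.

(** For [m = 0] this fails: the basis functions of the values do not vanish at the
    junctions.  It is here that the exactness of [f 0] and [f 1] in the boundary
    data matters. *)
Lemma hermite_basis_contact (r m : nat) : (1 <= m <= r)%nat ->
  contact 0 (fun _ => 0) (hermite_left r m) /\ contact 0 (fun _ => 0) (hermite_right r m).
Proof.
  intros Hm.
  destruct (hermite_left_near_0 r m ltac:(lia)) as [C1 [HC1 H1]].
  destruct (hermite_right_near_0 r m) as [C2 [HC2 H2]].
  pose proof (Rinv_0_lt_compat _ (INR_fact_lt_0 m)) as Hf.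
  assert (Hpow : forall k y, (1 <= k)%nat -> 0 <= y <= 1 -> y ^ k <= y).
  { intros k y Hk Hy. destruct k as [|k]; [lia|]. simpl.
    assert (y ^ k <= 1) by (rewrite <- (pow1 k); apply pow_incr; lra).
    assert (0 <= y ^ k) by (apply pow_le; lra). nra. }
  assert (HL : forall y, 0 <= y <= 1 -> Rabs (hermite_left r m y) <= (C1 + / INR (fact m)) * y ^ (0 + 1)).
  { intros y Hy. specialize (H1 y Hy). simpl (0 + 1)%nat. rewrite pow_1.
    replace (hermite_left r m y)
      with ((hermite_left r m y - / INR (fact m) * y ^ m) + / INR (fact m) * y ^ m) by ring.
    eapply Rle_trans; [apply Rabs_triang|].
    assert (0 <= y ^ m) by (apply pow_le; lra).
    rewrite (Rabs_pos_eq (/ _ * _)) by (apply Rmult_le_pos; lra).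
    pose proof (Rmult_le_compat_l C1 _ _ HC1 (Hpow (r + 1)%nat y ltac:(lia) Hy)).
    pose proof (Rmult_le_compat_l (/ INR (fact m)) _ _ ltac:(lra) (Hpow m y ltac:(lia) Hy)).
    lra. }
  assert (HR : forall y, 0 <= y <= 1 -> Rabs (hermite_right r m y) <= C2 * y ^ (0 + 1)).
  { intros y Hy. eapply Rle_trans; [apply H2; auto|]. apply Rmult_le_compat_l; auto.
    simpl (0 + 1)%nat. rewrite pow_1. apply Hpow; auto. lia. }
  set (C := C1 + / INR (fact m) + C2).
  assert (HC : 0 <= C) by (unfold C; lra).
  assert (HLC : forall y, 0 <= y <= 1 -> Rabs (hermite_left r m y) <= C * y ^ (0 + 1)).
  { intros y Hy. eapply Rle_trans; [apply HL; auto|].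
    apply Rmult_le_compat_r; [apply pow_le; lra|unfold C; lra]. }
  assert (HRC : forall y, 0 <= y <= 1 -> Rabs (hermite_right r m y) <= C * y ^ (0 + 1)).
  { intros y Hy. eapply Rle_trans; [apply HR; auto|].
    apply Rmult_le_compat_r; [apply pow_le; lra|unfold C; lra]. }
  split; exists C; (split; [auto|]); intros y Hy; unfold Rminus at 1 2; rewrite !Rplus_0_l, !Rabs_Ropp; split; auto.
  - replace (-1 - y) with (- 1 - y) by ring.
    rewrite <- (Rabs_sign_mult m), <- hermite_right_reflect. auto.
  - replace (-1 - y) with (- 1 - y) by ring.
    rewrite hermite_right_at_reflected, Rabs_sign_mult. auto.
Qed.

(** * Perturbation of the boundary data *)

Lemma RtoC_sum_n (u : nat -> R) (n : nat) : RtoC (sum_n u n) = csum (fun i => RtoC (u i)) (S n).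
Proof.
  induction n as [|n IH].
  - rewrite sum_O. simpl. ring.
  - rewrite sum_n_S_R, RtoC_plus, IH. reflexivity.
Qed.

Lemma hermite_plus (r : nat) (al be de ep : nat -> R) (x : R) :
  hermite r (fun m => al m + de m) (fun m => be m + ep m) x
  = hermite r al be x + hermite r de ep x.
Proof.
  unfold hermite.
  assert (E : forall u v w : nat -> R, sum_n (fun m => (u m + v m) * w m) r
    = sum_n (fun m => u m * w m) r + sum_n (fun m => v m * w m) r).
  { intros u v w. rewrite <- (sum_n_plus (G := R_AbelianMonoid)).
    apply sum_n_ext_R. intros m. change (@plus R_AbelianMonoid) with Rplus. ring. }
  rewrite !E. ring.
Qed.

Lemma trig_glue_perturbed (r n : nat) (f : R -> R) (al be de ep : nat -> R) (x : R) :
  trig n (fun j => RtoC (glue f (hermite r (fun m => al m + de m) (fun m => be m + ep m)) n j)) x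
  = (trig n (fun j => RtoC (glue f (hermite r al be) n j)) x
     + (csum (fun m => RtoC (de m) * trig n (fun j => RtoC (glue (fun _ => 0) (hermite_left r m) n j)) x) (S r)
     + csum (fun m => RtoC (ep m) * trig n (fun j => RtoC (glue (fun _ => 0) (hermite_right r m) n j)) x) (S r)))%C.
Proof.
  rewrite (csum_ext (fun m => RtoC (de m) * _)%C
    (fun m => trig n (fun j => RtoC (de m) * RtoC (glue (fun _ => 0) (hermite_left r m) n j))%C x))
    by (intros; rewrite trig_scal; reflexivity).
  rewrite (csum_ext (fun m => RtoC (ep m) * _)%C
    (fun m => trig n (fun j => RtoC (ep m) * RtoC (glue (fun _ => 0) (hermite_right r m) n j))%C x))
    by (intros; rewrite trig_scal; reflexivity).
  rewrite <- !trig_csum, <- !trig_plus. apply trig_ext. intros j _.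
  unfold glue. destruct (0 <=? j)%Z.
  - rewrite !csum_zero by (intros; ring). ring.
  - rewrite hermite_plus, RtoC_plus. f_equal. unfold hermite at 1.
    rewrite RtoC_plus, !RtoC_sum_n.
    f_equal; apply csum_ext; intros i _; apply RtoC_mult.
Qed.

(** A perturbation of the derivative data leaves the continuation continuous,
    so that its effect on [[0, 1]], where the perturbing functions are glued to
    [0], is smaller than the perturbation by a factor [1 / n]. *)
Lemma perturbation_error (r p : nat) (P : nat -> R -> R) (de : nat -> nat -> R) :
  (forall m, diff_smooth (P m)) ->
  (forall m, (1 <= m <= r)%nat -> contact 0 (fun _ => 0) (P m)) ->
  (forall n, de 0%nat n = 0) ->
  (forall m, (1 <= m <= r)%nat ->
     big_O (fun n => Finite (de m n)) (fun n => / INR n ^ p)) ->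
  exists K, 0 <= K /\ eventually (fun n => forall x, 0 <= x <= 1 ->
    Cmod (csum (fun m => RtoC (de m n) *
                 trig n (fun j => RtoC (glue (fun _ => 0) (P m) n j)) x)%C (S r))
    <= K / INR n ^ (p + 1)).
Proof.
  intros HP Hc H0 Hde.
  cut (forall k, (k <= r)%nat -> exists K, 0 <= K /\ eventually (fun n => forall x, 0 <= x <= 1 ->
    Cmod (csum (fun m => RtoC (de m n) *
                 trig n (fun j => RtoC (glue (fun _ => 0) (P m) n j)) x)%C (S k))
    <= K / INR n ^ (p + 1))).
  { intros H. apply H. lia. }
  induction k as [|k IH]; intros Hk.
  - exists 0. split; [lra|]. exists 1%nat. intros n Hn x Hx. simpl csum. rewrite H0.
    replace (_ + _)%C with (RtoC 0) by ring. rewrite Cmod_0. unfold Rdiv. lra.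
  - destruct (IH ltac:(lia)) as [K1 [HK1 [N1 H1]]].
    destruct (continuation_error 0 (fun _ => 0) (P (S k))) as [K2 [HK2 H2]]; auto.
    { exists nil, 0. split; [lra|]. intros N j HN _ _.
      assert (E : fdiff (0 + 2) (/ INR N) (fun _ => 0) (IZR j / INR N) = 0) by (simpl; ring).
      rewrite E, Rabs_R0. unfold Rdiv. rewrite !Rmult_0_l. split; intros; lra. }
    { apply Hc. lia. }
    { intros x _. apply filterlim_const. }
    destruct (Hde (S k) ltac:(lia)) as [K3 [N3 H3]].
    exists (K1 + Rabs K3 * K2).
    split; [apply Rplus_le_le_0_compat; auto; apply Rmult_le_pos; auto using Rabs_pos|].
    exists (S (N1 + N3)). intros n Hn x Hx.
    assert (Hn' : 0 < INR n) by (apply lt_0_INR; lia).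
    specialize (H1 n ltac:(lia) x Hx). specialize (H2 n x ltac:(lia) Hx).
    specialize (H3 n ltac:(lia)). simpl in H3.
    change (csum ?u (S (S k))) with (csum u (S k) + u (S k))%C.
    eapply Rle_trans; [apply Cmod_triangle|].
    replace ((K1 + Rabs K3 * K2) / INR n ^ (p + 1))
      with (K1 / INR n ^ (p + 1) + Rabs K3 * / INR n ^ p * (K2 / INR n ^ (0 + 1))).
    2:{ rewrite pow_add. simpl (0 + 1)%nat. rewrite pow_1. field.
        split; [|apply pow_nonzero]; lra. }
    apply Rplus_le_compat; auto.
    rewrite Cmod_mult, Cmod_R.
    assert (Hp : 0 < / INR n ^ p) by (apply Rinv_0_lt_compat, pow_lt; auto).
    rewrite (Rabs_pos_eq (/ _)) in H3 by lra.
    apply Rmult_le_compat; auto using Rabs_pos, Cmod_ge_0.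
    + eapply Rle_trans; [exact H3|]. apply Rmult_le_compat_r; [lra|apply Rle_abs].
    + replace (trig n _ x) with
        (trig n (fun j => RtoC (glue (fun _ => 0) (P (S k)) n j)) x - RtoC 0)%C by ring.
      exact H2.
Qed.

Lemma norm_infty_le (h : R -> C) (M : R) :
  (forall x, 0 <= x <= 1 -> Cmod (h x) <= M) ->
  Rbar_le (Rbar_abs (norm_infty 0 1 h)) (Finite M).
Proof.
  intros H. unfold norm_infty.
  set (E := fun y => exists x, Icc 0 1 x /\ y = Cmod (h x)).
  destruct (Lub_Rbar_correct E) as [Hub Hlub].
  assert (H0 : Rbar_le (Cmod (h 0)) (Lub_Rbar E)).
  { apply Hub. exists 0. split; auto. unfold Icc. lra. }
  assert (H1 : Rbar_le (Lub_Rbar E) M).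
  { apply Hlub. intros y [x [Hx ->]]. apply H. exact Hx. }
  pose proof (Cmod_ge_0 (h 0)).
  destruct (Lub_Rbar E) as [l| |]; simpl in *; auto; try contradiction.
  rewrite Rabs_pos_eq; lra.
Qed.

Theorem mainTheorem2 (r p : nat) (hr : (1 <= r)%nat) (hp : (1 <= p)%nat)
  (f : R -> R) (hf : D_r1 r 0 1 f)
  (a : nat -> nat -> R)
  (ha0 : forall m : nat, (1 <= m <= r)%nat ->
     big_O (fun n : nat =>
              Finite (fin_diff 1 (a m) p n m f 0 - Derive_n_on (Icc 0 1) f m 0))
           (fun n : nat => / INR n ^ p))
  (ha1 : forall m : nat, (1 <= m <= r)%nat ->
     big_O (fun n : nat =>
              Finite (fin_diff (-1) (a m) p n m f (Z.of_nat n)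
                      - Derive_n_on (Icc 0 1) f m 1))
           (fun n : nat => / INR n ^ p)) :
  big_O (fun n : nat =>
           norm_infty 0 1
             (fun x : R =>
                (disc_fourier n (disc_cont r p n a f) x - RtoC (f x))%C))
        (fun n : nat => / INR n ^ (Nat.min p r + 1)).
Proof.
  set (al := fun m => Derive_n_on (Icc 0 1) f m 0).
  set (be := fun m => Derive_n_on (Icc 0 1) f m 1).
  (* the values at [0] and [1] are exact: only rows of order [m >= 1] are perturbed *)
  set (de := fun m n => match m with O => 0 | S _ => fin_diff 1 (a m) p n m f 0 - al m end).
  set (ep := fun m n => match m with O => 0
                        | S _ => fin_diff (-1) (a m) p n m f (Z.of_nat n) - be m end).
  destruct (continuation_error r f (hermite r al be)) as [K0 [HK0 H0]].
  { apply D_r1_diff_piecewise, hf. }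
  { apply hermite_smooth. }
  { apply hermite_contact, hf. }
  { apply (D_r1_continuous r f hf). }
  destruct (perturbation_error r p (hermite_left r) de) as [K1 [HK1 [N1 H1]]]; auto.
  { apply hermite_left_smooth. }
  { intros m Hm. apply (hermite_basis_contact r m Hm). }
  { intros m Hm. destruct m as [|m]; [lia|]. apply ha0; auto. }
  destruct (perturbation_error r p (hermite_right r) ep) as [K2 [HK2 [N2 H2]]]; auto.
  { apply hermite_right_smooth. }
  { intros m Hm. apply (hermite_basis_contact r m Hm). }
  { intros m Hm. destruct m as [|m]; [lia|]. apply ha1; auto. }
  exists (K0 + K1 + K2), (S (N1 + N2)). intros n Hn.
  pose proof (le_INR 1 n ltac:(lia)) as Hn1. simpl (INR 1) in Hn1.
  apply norm_infty_le. intros x Hx.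
  rewrite (Rabs_pos_eq (/ _)) by (left; apply Rinv_0_lt_compat, pow_lt; lra).
  rewrite disc_fourier_trig by lia.
  rewrite (trig_ext n _ (fun j => RtoC (glue f
     (hermite r (fun m => al m + de m n) (fun m => be m + ep m n)) n j))).
  2:{ intros j _. f_equal. unfold disc_cont, glue. destruct (0 <=? j)%Z; [reflexivity|].
      rewrite Hermite_P_hermite. unfold hermite, bdry_data.
      f_equal; apply sum_n_ext_loc; intros m Hm; rewrite coeff_mat_bij by lia; f_equal;
        unfold de, ep, al, be; destruct m; simpl; ring. }
  rewrite trig_glue_perturbed.
  specialize (H0 n x ltac:(lia) Hx). specialize (H1 n ltac:(lia) x Hx).
  specialize (H2 n ltac:(lia) x Hx).
  match goal with |- Cmod (?t0 + (?t1 + ?t2) - ?t3) <= _ =>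
    replace (t0 + (t1 + t2) - t3)%C with ((t0 - t3) + (t1 + t2))%C by ring end.
  eapply Rle_trans; [apply Cmod_triangle|].
  eapply Rle_trans; [apply Rplus_le_compat_l, Cmod_triangle|].
  assert (Hmono : forall K k, 0 <= K -> (Nat.min p r <= k)%nat ->
    K / INR n ^ (k + 1) <= K * / INR n ^ (Nat.min p r + 1)).
  { intros K k HK Hk. apply Rmult_le_compat_l; auto. apply Rinv_le_contravar.
    - apply pow_lt. lra.
    - apply Rle_pow; [lra|lia]. }
  pose proof (Hmono K0 r HK0 ltac:(lia)). pose proof (Hmono K1 p HK1 ltac:(lia)).
  pose proof (Hmono K2 p HK2 ltac:(lia)). cbv beta in *. lra.
Qed.
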